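(* Let $f:\mathbb{R}^n\to\mathbb{R}$ be locally Lipschitz on $\mathbb{R}^n$ and continuously differentiable on an open set $D\subseteq\mathbb{R}^n$ whose complement has Lebesgue measure zero. Suppose Algorithm GS (described in the context) is run with $\nu_0=\nu_{\mathrm{opt}}=0$, $\epsilon_0=\epsilon_{\mathrm{opt}}=\epsilon>0$, and $\theta_\epsilon=1$. Then, with probability one, the algorithm is well defined in the sense that the gradients $\nabla f(x^k),\nabla f(x^{k,1}),\dots,\nabla f(x^{k,m})$ used in the direction computation exist at every iteration, and one of the following occurs: (a) $f(x^k)\searrow-\infty$; or (b) the algorithm terminates at some iteration $k$ with $g^k=0$; or (c) there exists an index set $\mathcal{K}\subseteq\mathbb{N}$ with $\{g^k\}_{k\in\mathcal{K}}\to 0$ such that every cluster point of $\{x^k\}_{k\in\mathcal{K}}$ is Clarke $\epsilon$-stationary for $f$.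
   Context: Notation: $\|\cdot\|_2$ is the Euclidean norm, $\mathbb{B}(x,\epsilon):=\{y\in\mathbb{R}^n:\|y-x\|_2\le\epsilon\}$, and $\mathrm{conv}$ denotes convex hull. Clarke subdifferential (for locally Lipschitz $f$): $\bar\partial f(x)=\mathrm{conv}\{\lim_{j\to\infty}\nabla f(y^j): y^j\to x,\ f \text{ differentiable at } y^j \text{ for all } j\}$. Clarke $\epsilon$-subdifferential: $\bar\partial_\epsilon f(x)=\mathrm{conv}\big(\bigcup_{y\in\mathbb{B}(x,\epsilon)}\bar\partial f(y)\big)$. A point $x$ is Clarke $\epsilon$-stationary for $f$ if $0\in\bar\partial_\epsilon f(x)$. Algorithm GS. Inputs: an initial point $x^0$ at which $f$ is differentiable; initial sampling radius $\epsilon_0\in(0,\infty)$; initial stationarity target $\nu_0\in[0,\infty)$; sample size $m\ge n+1$; line search parameters $(\beta,\gamma)\in(0,1)\times(0,1)$; termination tolerances $(\epsilon_{\mathrm{opt}},\nu_{\mathrm{opt}})\in[0,\infty)\times[0,\infty)$; reduction factors $(\theta_\epsilon,\theta_\nu)\in(0,1]\times(0,1]$. For $k=0,1,2,\dots$: 1. Independently sample $x^{k,1},\dots,x^{k,m}$ uniformly from $\mathbb{B}(x^k,\epsilon_k)$. 2. Compute $g^k$ as the minimizer of $\tfrac12\|g\|_2^2$ over $g\in\mathrm{conv}\{\nabla f(x^k),\nabla f(x^{k,1}),\dots,\nabla f(x^{k,m})\}$. 3. If $\|g^k\|_2\le\nu_{\mathrm{opt}}$ and $\epsilon_k\le\epsilon_{\mathrm{opt}}$,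 terminate. 4. If $\|g^k\|_2\le\nu_k$, set $\nu_{k+1}=\theta_\nu\nu_k$, $\epsilon_{k+1}=\theta_\epsilon\epsilon_k$, $t_k=0$; otherwise set $\nu_{k+1}=\nu_k$, $\epsilon_{k+1}=\epsilon_k$, and $t_k=\max\{t\in\{1,\gamma,\gamma^2,\dots\}: f(x^k-tg^k)<f(x^k)-\beta t\|g^k\|_2^2\}$. 5. If $f$ is differentiable at $x^k-t_kg^k$, set $x^{k+1}=x^k-t_kg^k$; otherwise set $x^{k+1}$ randomly as any point at which $f$ is differentiable such that $f(x^{k+1})<f(x^k)-\beta t_k\|g^k\|_2^2$ and $\|x^k-t_kg^k-x^{k+1}\|_2\le\min\{t_k,\epsilon_k\}\|g^k\|_2$. *)

(* Defs.v *)
From HB Require Import structures.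
From mathcomp Require Import all_boot all_order all_algebra.
From mathcomp Require Import all_classical all_reals all_analysis.
Set Implicit Arguments. Unset Strict Implicit. Unset Printing Implicit Defensive.
Import Order.TTheory GRing.Theory Num.Theory.
Import numFieldNormedType.Exports.
Local Open Scope classical_set_scope.
Local Open Scope ring_scope.

Section GSDefs.
Variables (R : realType) (n : nat).
Local Notation V := 'rV[R]_n.

Definition enorm (v : V) : R := Num.sqrt (\sum_(i < n) v ord0 i ^+ 2).
Definition eball (x : V) (e : R) : set V := [set y | enorm (y - x) <= e].

Definition conv (A : set V) : set V :=
  [set v | exists s : seq (R * V),
      (forall p, p \in s -> 0 <= p.1 /\ A p.2) /\
      \sum_(p <- s) p.1 = 1 /\
      v = \sum_(p <- s) p.1 *: p.2].

Definition grad (f : V -> R) (x : V) : V :=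
  \row_(i < n) ('d f x : V -> R) (delta_mx ord0 i).

Definition locally_lipschitz (f : V -> R) : Prop :=
  forall x, exists r, 0 < r /\ exists L : R,
    forall y z, eball x r y -> eball x r z -> `|f y - f z| <= L * enorm (y - z).

Definition C1_on (f : V -> R) (D : set V) : Prop :=
  (forall x, D x -> differentiable f x) /\
  (forall x, D x -> {for x, continuous (grad f)}).

Definition box (a b : V) : set V := [set y | forall i, a ord0 i <= y ord0 i <= b ord0 i].
Definition boxvol (a b : V) : R := \prod_(i < n) (b ord0 i - a ord0 i).
Definition leb_outer (A : set V) : \bar R :=
  ereal_inf [set z | exists a b : nat -> V,
     (forall k i, a k ord0 i <= b k ord0 i) /\
     A `<=` \bigcup_k box (a k) (b k) /\
     z = (\sum_(k <oo) (boxvol (a k) (b k))%:E)%E].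
Definition lebesgue_null (A : set V) : Prop := leb_outer A = 0%E.

Definition clarke_subdiff (f : V -> R) (x : V) : set V :=
  conv [set v | exists y : nat -> V, y @ \oo --> x /\
          (forall j, differentiable f (y j)) /\ (grad f \o y) @ \oo --> v].
Definition clarke_eps_subdiff (f : V -> R) (e : R) (x : V) : set V :=
  conv (\bigcup_(y in eball x e) clarke_subdiff f y).
Definition clarke_eps_stationary (f : V -> R) (e : R) (x : V) : Prop :=
  clarke_eps_subdiff f e x 0.

(** Algorithm GS, one realisation (omega fixed).  x k = x^k,
    S k i = x^{k,i}, epsk/nuk = eps_k/nu_k, g k = g^k, t k = t_k. *)
Definition GS_defined_at (f : V -> R) (m : nat) (x : nat -> V) (S : nat -> 'I_m -> V)
  (k : nat) : Prop :=
  differentiable f (x k) /\ forall i, differentiable f (S k i).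

Definition GS_stop (eps_opt nu_opt : R) (epsk : nat -> R) (g : nat -> V) (k : nat) : Prop :=
  enorm (g k) <= nu_opt /\ epsk k <= eps_opt.

Definition min_norm_elt (A : set V) (g : V) : Prop :=
  conv A g /\ forall h, conv A h -> enorm g <= enorm h.

Definition GS_run (f : V -> R) (m : nat) (x0 : V) (eps0 nu0 beta gamma eps_opt nu_opt
    theta_eps theta_nu : R) (x : nat -> V) (S : nat -> 'I_m -> V)
    (epsk nuk : nat -> R) (g : nat -> V) (t : nat -> R) : Prop :=
  x 0%N = x0 /\ epsk 0%N = eps0 /\ nuk 0%N = nu0 /\
  forall k,
    (forall j, (j <= k)%N -> GS_defined_at f x S j) ->
    (forall j, (j < k)%N -> ~ GS_stop eps_opt nu_opt epsk g j) ->
    min_norm_elt ([set grad f (x k)] `|` [set grad f (S k i) | i in setT]) (g k) /\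
    (~ GS_stop eps_opt nu_opt epsk g k ->
      ((enorm (g k) <= nuk k ->
          nuk k.+1 = theta_nu * nuk k /\ epsk k.+1 = theta_eps * epsk k /\ t k = 0) /\
       (~ (enorm (g k) <= nuk k) ->
          nuk k.+1 = nuk k /\ epsk k.+1 = epsk k /\
          exists j : nat, t k = gamma ^+ j /\
            f (x k - t k *: g k) < f (x k) - beta * t k * enorm (g k) ^+ 2 /\
            forall j', (j' < j)%N ->
              ~ (f (x k - gamma ^+ j' *: g k) < f (x k) - beta * gamma ^+ j' * enorm (g k) ^+ 2))) /\
      (differentiable f (x k - t k *: g k) -> x k.+1 = x k - t k *: g k) /\
      (~ differentiable f (x k - t k *: g k) ->
          differentiable f (x k.+1) /\
          f (x k.+1) < f (x k) - beta * t k * enorm (g k) ^+ 2 /\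
          enorm (x k - t k *: g k - x k.+1) <= Num.min (t k) (epsk k) * enorm (g k))).

End GSDefs.

Section Prob.
Variables (R : realType) (n : nat) (d : measure_display) (T : measurableType d)
  (P : probability T R).
Local Notation V := 'rV[R]_n.

Definition borelV (A : set V) : Prop := <<s [set U : set V | open U] >> A.

Definition prob (A : set T) : R := fine (P A).

Definition random_vector (X : T -> V) : Prop :=
  forall A, borelV A -> measurable (X @^-1` A).

Definition cyl (I : eqType) (X : I -> T -> V) (s : seq I) (A : I -> set V) : set T :=
  [set w | forall i, i \in s -> A i (X i w)].

Definition mutually_indep (I : eqType) (X : I -> T -> V) : Prop :=
  forall (s : seq I) (A : I -> set V), uniq s -> (forall i, borelV (A i)) ->
    prob (cyl X s A) = \prod_(i <- s) prob (X i @^-1` A i).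

(** Independence of the sigma-algebras generated by two families. *)
Definition indep_families (I J : eqType) (X : I -> T -> V) (Y : J -> T -> V) : Prop :=
  forall (s : seq I) (t : seq J) (A : I -> set V) (B : J -> set V),
    (forall i, borelV (A i)) -> (forall j, borelV (B j)) ->
    prob (cyl X s A `&` cyl Y t B) = prob (cyl X s A) * prob (cyl Y t B).

Definition uniform_unit_ball (U : T -> V) : Prop :=
  forall A, borelV A ->
    prob (U @^-1` A) = fine (leb_outer (A `&` eball 0 1)) / fine (leb_outer (eball (0 : V) 1)).

(** History available before the sampling of iteration k:
    x^0..x^k and the normalized samples of iterations 0..k-1. *)
Definition hist_idx (k m : nat) : Type := ('I_k.+1 + ('I_k * 'I_m))%type.
Definition history (m : nat) (x : nat -> T -> V) (u : nat -> 'I_m -> T -> V) (k : nat) :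
  hist_idx k m -> T -> V :=
  fun h => match h with inl j => x (nat_of_ord j) | inr (j, i) => u (nat_of_ord j) i end.

End Prob.
Arguments history {R n d T m} x u k.

(* Main.v *)
Require Import Defs.
From HB Require Import structures.
From mathcomp Require Import all_boot all_order all_algebra.
From mathcomp Require Import all_classical all_reals all_analysis.
From mathcomp Require Import measurable_realfun ring lra.
Import Order.TTheory GRing.Theory Num.Theory.
Import numFieldNormedType.Exports.
Set Implicit Arguments.
Unset Strict Implicit.
Unset Printing Implicit Defensive.
Local Open Scope classical_set_scope.
Local Open Scope ring_scope.

(** The uniform law on a ball lets one move off the null set where [f] is not
    smooth: along randomly translated parallel segments, few short steps start at
    a bad point, so a bound on the directional derivative over [D] bounds the
    increments of [f] everywhere (a mean value theorem replacing Lebourg's).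
    Hence, near any [xbar], samples close to the at most [n + 1] points that
    support an almost shortest convex combination of gradients over
    [B(xbar, eps)] either give a small [g], or give a [g] for which the line
    search accepts every step below a fixed length. Such samples almost surely
    occur infinitely often, for all positions at once, since a product of balls
    inside the unit ball has positive probability at each iteration and the
    iterations are independent of the past.
    If [f (x k)] is bounded below while the gradients stay away from [0], then
    [x k] has finite length, so converges, and [t k] tends to [0]: this
    contradicts the previous point at the limit. Otherwise the strict record lows
    of [enorm (g k)] form the index set of (c), and outer semicontinuity of the
    Clarke eps-subdifferential concludes. *)

(* The unqualified name is shadowed by the convex combinations of MathComp-Analysis. *)
Local Notation conv := Defs.conv.

(** * The Euclidean norm *)

Section Euclid.
Variables (R : realType) (n : nat).
Local Notation V := 'rV[R]_n.
Implicit Types u v w : V.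

Definition dot u v : R := \sum_(i < n) u ord0 i * v ord0 i.

Lemma dotC u v : dot u v = dot v u.
Proof. by apply: eq_bigr => i _; rewrite mulrC. Qed.

Lemma dotDl u v w : dot (u + v) w = dot u w + dot v w.
Proof. by rewrite -big_split; apply: eq_bigr => i _; rewrite !mxE mulrDl. Qed.

Lemma dotZl a u v : dot (a *: u) v = a * dot u v.
Proof. by rewrite mulr_sumr; apply: eq_bigr => i _; rewrite !mxE mulrA. Qed.

Lemma dotNl u v : dot (- u) v = - dot u v.
Proof. by rewrite -scaleN1r dotZl mulN1r. Qed.

Lemma dotDr u v w : dot w (u + v) = dot w u + dot w v.
Proof. by rewrite dotC dotDl !(dotC w). Qed.

Lemma dotZr a u v : dot u (a *: v) = a * dot u v.
Proof. by rewrite dotC dotZl dotC. Qed.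

Lemma dotNr u v : dot u (- v) = - dot u v.
Proof. by rewrite dotC dotNl dotC. Qed.

Lemma dot0l u : dot 0 u = 0.
Proof. by rewrite -(scale0r u) dotZl mul0r. Qed.

Lemma dot_sumr I (s : seq I) (F : I -> V) u :
  dot u (\sum_(i <- s) F i) = \sum_(i <- s) dot u (F i).
Proof.
elim: s => [|a s IH]; first by rewrite !big_nil dotC dot0l.
by rewrite !big_cons dotDr IH.
Qed.

Lemma dot_ge0 u : 0 <= dot u u.
Proof. by apply: sumr_ge0 => i _; rewrite -expr2 sqr_ge0. Qed.

Lemma enorm_ge0 u : 0 <= enorm u.
Proof. exact: sqrtr_ge0. Qed.

Lemma sqr_enorm u : enorm u ^+ 2 = dot u u.
Proof.
rewrite /enorm sqr_sqrtr; last by apply: sumr_ge0 => i _; rewrite sqr_ge0.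
by apply: eq_bigr => i _; rewrite expr2.
Qed.

Lemma coord_le_enorm u i : `|u ord0 i| <= enorm u.
Proof.
rewrite -sqrtr_sqr ler_wsqrtr // (bigD1 i) //= lerDl.
by apply: sumr_ge0 => j _; rewrite sqr_ge0.
Qed.

Lemma enorm0 : enorm (0 : V) = 0.
Proof. by apply/eqP; rewrite -sqrf_eq0 sqr_enorm dot0l. Qed.

Lemma enorm_eq0 u : enorm u = 0 -> u = 0.
Proof.
move=> u0; apply/rowP => i; rewrite mxE; apply/normr0_eq0/eqP.
by rewrite -normr_le0 normr_id -u0 coord_le_enorm.
Qed.

Lemma enorm_le0 u : enorm u <= 0 -> u = 0.
Proof. by move=> u0; apply: enorm_eq0; apply/eqP; rewrite eq_le u0 enorm_ge0. Qed.

Lemma cauchy_schwarz u v : dot u v <= enorm u * enorm v.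
Proof.
have [a0|] := eqVneq (enorm u) 0.
  by rewrite a0 (enorm_eq0 a0) dot0l mul0r.
have [b0|b0 a0] := eqVneq (enorm v) 0.
  by rewrite b0 (enorm_eq0 b0) dotC dot0l mulr0.
have a_gt0 : 0 < enorm u by rewrite lt0r a0 enorm_ge0.
have b_gt0 : 0 < enorm v by rewrite lt0r b0 enorm_ge0.
have := dot_ge0 (enorm v *: u - enorm u *: v).
rewrite !(dotDl, dotDr, dotNl, dotNr, dotZl, dotZr) (dotC v u) -!sqr_enorm => h.
have {}h : 0 <= (enorm u * enorm v) * (enorm u * enorm v - dot u v) by lra.
by rewrite -subr_ge0 -(pmulr_rge0 _ (mulr_gt0 a_gt0 b_gt0)).
Qed.

Lemma cauchy_schwarz_abs u v : `|dot u v| <= enorm u * enorm v.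
Proof.
rewrite ler_norml cauchy_schwarz andbT lerNl -dotNl.
apply: le_trans (cauchy_schwarz _ _) _.
suff -> : enorm (- u) = enorm u by [].
by rewrite /enorm; congr Num.sqrt; apply: eq_bigr => i _; rewrite mxE sqrrN.
Qed.

Lemma ler_enormD u v : enorm (u + v) <= enorm u + enorm v.
Proof.
rewrite -(@ler_pXn2r _ 2%N) ?nnegrE ?addr_ge0 ?enorm_ge0 //.
rewrite sqr_enorm !(dotDl, dotDr) sqrrD !sqr_enorm (dotC v u).
have := cauchy_schwarz u v; lra.
Qed.

Lemma enormZ a u : enorm (a *: u) = `|a| * enorm u.
Proof.
apply/eqP; rewrite -(@eqrXn2 _ 2%N) ?mulr_ge0 ?enorm_ge0 //.
by rewrite exprMn !sqr_enorm dotZl dotZr mulrA real_normK ?num_real // expr2.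
Qed.

Lemma enormN u : enorm (- u) = enorm u.
Proof. by rewrite -scaleN1r enormZ normrN1 mul1r. Qed.

Lemma enormBC u v : enorm (u - v) = enorm (v - u).
Proof. by rewrite -enormN opprB. Qed.

Lemma ler_enormB_trans v u w : enorm (u - w) <= enorm (u - v) + enorm (v - w).
Proof. by apply: le_trans (ler_enormD _ _); rewrite addrA subrK. Qed.

Lemma ler_enorm_sum I (s : seq I) (F : I -> V) :
  enorm (\sum_(i <- s) F i) <= \sum_(i <- s) enorm (F i).
Proof.
elim: s => [|a s IH]; first by rewrite !big_nil enorm0.
by rewrite !big_cons; apply: le_trans (ler_enormD _ _) _; rewrite lerD2l.
Qed.

Lemma norm_le_enorm u : `|u| <= enorm u.
Proof.
rewrite /Num.norm /= mx_normrE; apply/bigmax_leP; split => [|[i j] _ /=].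
  exact: enorm_ge0.
by rewrite (ord1 i) coord_le_enorm.
Qed.

Lemma coord_le_norm u i : `|u ord0 i| <= `|u|.
Proof.
rewrite [in leRHS]/Num.norm /= mx_normrE.
exact: (le_bigmax _ (fun ij : 'I_1 * 'I_n => `|u ij.1 ij.2|) (ord0, i)).
Qed.

Lemma enorm_le_norm u : enorm u <= n.+1%:R * `|u|.
Proof.
rewrite -(@ler_pXn2r _ 2%N) ?nnegrE ?mulr_ge0 ?enorm_ge0 // sqr_enorm.
have : dot u u <= n%:R * `|u| ^+ 2.
  rewrite mulr_natl -[X in _ *+ X](card_ord n) -sumr_const.
  apply: ler_sum => i _; rewrite -expr2 -real_normK ?num_real //.
  by rewrite ler_pXn2r ?nnegrE ?coord_le_norm.
move=> /le_trans; apply; rewrite exprMn ler_wpM2r ?sqr_ge0 //.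
by rewrite -natrX ler_nat; apply: leq_trans (leqnSn n) _; rewrite leq_pmulr.
Qed.

(** The topology on row vectors comes from the sup norm; the two comparisons of norms carry
    convergence over to [enorm]. *)
Lemma cvg_enormP (T : Type) (F : set_system T) (FF : Filter F) (h : T -> V) v :
  (h @ F --> v) <-> (forall e, 0 < e -> \forall t \near F, enorm (h t - v) < e).
Proof.
split => [/cvgrPdist_lt hv e e0|hv].
  have e1 : 0 < e / n.+1%:R by rewrite divr_gt0.
  near=> t; apply: le_lt_trans (enorm_le_norm _) _.
  rewrite mulrC -ltr_pdivlMr // distrC; near: t; exact: hv.
apply/cvgrPdist_lt => e e0; near=> t; rewrite distrC.
apply: le_lt_trans (norm_le_enorm _) _; near: t; exact: hv.
Unshelve. all: by end_near. Qed.

Lemma near_enormP v (Q : set V) :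
  (\forall y \near v, Q y) <-> (exists2 e, 0 < e & forall y, enorm (y - v) < e -> Q y).
Proof.
split => [/nbhs_ballP[e /= e0 he]|[e e0 he]].
  exists e => // y ye; apply: he; rewrite -ball_normE /= distrC.
  exact: le_lt_trans (norm_le_enorm _) ye.
near=> y; apply: he; near: y.
have := (cvg_enormP (nbhs_filter v) id v).1 cvg_id; exact.
Unshelve. all: by end_near. Qed.

Lemma open_enormP (A : set V) :
  open A <-> (forall v, A v -> exists2 e, 0 < e & forall y, enorm (y - v) < e -> A y).
Proof.
rewrite openE; split => [oA v Av|oA v Av].
  exact/near_enormP/oA.
exact/near_enormP/oA.
Qed.

Lemma open_eball z r : open [set y : V | enorm (y - z) < r].
Proof.
apply/open_enormP => v /= vr; exists (r - enorm (v - z)); first by rewrite subr_gt0.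
move=> y yv; by apply: le_lt_trans (ler_enormB_trans v _ _) _; rewrite -ltrBrDr.
Qed.

Lemma closed_eball z r : closed (eball z r : set V).
Proof.
rewrite -openC; apply/open_enormP => v /= /negP; rewrite -ltNge => vr.
exists (enorm (v - z) - r); first by rewrite subr_gt0.
move=> y yv /=; apply/negP; rewrite -ltNge.
rewrite /= in yv; have := ler_enormB_trans y v z; rewrite (enormBC v y).
move: yv vr; rewrite /eball /=; lra.
Qed.

Lemma compact_eball z r : compact (eball z r : set V).
Proof.
apply: bounded_closed_compact; last exact: closed_eball.
exists (r + enorm z); split; first exact: num_real.
move=> M Mr y yr /=; apply: le_trans (norm_le_enorm _) _.
have := ler_enormB_trans z y 0; rewrite !subr0; move: yr; rewrite /eball /=; lra.
Qed.

End Euclid.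

(** * Gradients and local Lipschitz bounds *)

Section LipschitzGradient.
Variables (R : realType) (n : nat).
Local Notation V := 'rV[R]_n.
Implicit Types (f : V -> R) (x d : V).

(** Compactness is used as a near-covering property along [L --> +oo], so a single [L] serves as
    Lipschitz constant and, inverted, as admissible radius. The second point may lie outside [K]. *)
Lemma locally_lipschitz_uniform f (K : set V) : locally_lipschitz f -> compact K ->
  exists2 L, 0 < L & forall y z, K y -> enorm (z - y) <= L^-1 ->
    `|f z - f y| <= L * enorm (z - y).
Proof.
move=> fL /compact_near_coveringP cK.
have : \forall L \near +oo, K `<=` [set y | forall z, enorm (z - y) <= L^-1 ->
    `|f z - f y| <= L * enorm (z - y)].
  apply: cK => x _; have [r [r0 [L0 hL]]] := fL x.
  near=> y L => z zy.
  have yx : enorm (y - x) < r / 2.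
    near: y; apply/near_enormP; exists (r / 2) => //; exact: divr_gt0.
  have L2 : 2 / r < L by near: L; apply: nbhs_pinfty_gt; exact: num_real.
  have L00 : L0 < L by near: L; apply: nbhs_pinfty_gt; exact: num_real.
  have Lr : L^-1 < r / 2.
    have r2 : 0 < 2 / r by rewrite divr_gt0.
    by rewrite -[r / 2]invf_div ltf_pV2 // posrE; apply: lt_trans L2.
  apply: le_trans (hL _ _ _ _) _; rewrite /eball /=; [|lra|].
    by have := ler_enormB_trans y z x; lra.
  by rewrite ler_wpM2r ?enorm_ge0 // ltW.
move=> hK.
have [L [L0 hL]] : exists L, 0 < L /\ K `<=` [set y | forall z, enorm (z - y) <= L^-1 ->
    `|f z - f y| <= L * enorm (z - y)].
  apply: (@filter_ex _ +oo); near=> L; split; last by near: L.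
  by near: L; apply: nbhs_pinfty_gt; exact: num_real.
by exists L => // y z Ky zy; exact: hL.
Unshelve. all: by end_near. Qed.

Lemma diff_grad f x d : differentiable f x -> 'd f x d = dot (grad f x) d.
Proof.
move=> fx; rewrite {1}(row_sum_delta d) linear_sum /=.
by apply: eq_bigr => i _; rewrite linearZ /= mxE mulrC.
Qed.

Lemma grad_expansion f x d e : differentiable f x -> 0 < e ->
  exists2 h0, 0 < h0 & forall h, 0 < h < h0 ->
    `|f (x + h *: d) - f x - h * dot (grad f x) d| <= e * h.
Proof.
move=> fx e0.
have dfx : derivable f x d by exact: diff_derivable.
have : (fun h : R => h^-1 *: (f (h *: d + x) - f x)) @ 0^' --> dot (grad f x) d.
  rewrite -diff_grad // -deriveE //; exact: dfx.
move=> /cvgrPdist_le /(_ e e0) /nbhs_ballP[h0 /= h00 hh]; exists h0 => // h /andP[h_gt0 hh0].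
have /hh /= hh1 : ball (0:R) h0 h by rewrite -ball_normE /= sub0r normrN gtr0_norm.
have := hh1 (lt0r_neq0 h_gt0).
rewrite -(ler_pM2r h_gt0); apply: le_trans.
rewrite -[X in _ <= _ * X](gtr0_norm h_gt0) -normrM -[leLHS]normrN.
rewrite le_eqVlt; apply/orP; left; apply/eqP; congr (`|_|).
rewrite /GRing.scale /= (addrC x); field.
exact: lt0r_neq0.
Qed.

(** A short step along the gradient itself increases [f] by nearly the step times the squared norm,
    which the Lipschitz bound limits. *)
Lemma norm_grad_le f (L : R) x : differentiable f x -> 0 < L ->
  (forall z, enorm (z - x) <= L^-1 -> `|f z - f x| <= L * enorm (z - x)) ->
  enorm (grad f x) <= L.
Proof.
move=> fx L0 hL; set G := grad f x; apply/ler_addgt0Pr => e e0.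
have [->|G0] := eqVneq (enorm G) 0; first by rewrite addr_ge0 // ltW.
have Gp : 0 < enorm G by rewrite lt0r G0 enorm_ge0.
have [h0 h00 hh] := grad_expansion G fx (mulr_gt0 e0 Gp).
have LG : 0 < L^-1 / enorm G by rewrite divr_gt0 // invr_gt0.
pose h := Num.min (h0 / 2) (L^-1 / enorm G).
have hp : 0 < h by rewrite lt_min LG divr_gt0.
have hlt : h < h0 by rewrite gt_min; apply/orP; left; lra.
have /hh : 0 < h < h0 by rewrite hp.
have xh : enorm (x + h *: G - x) = h * enorm G by rewrite addrC addKr enormZ gtr0_norm.
have /hL : enorm (x + h *: G - x) <= L^-1.
  by rewrite xh -ler_pdivlMr // ge_min lexx orbT.
rewrite xh -/G -sqr_enorm !ler_norml => /andP[_ h1] /andP[h2 _].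
have : (h * enorm G) * enorm G <= (h * enorm G) * (L + e) by lra.
by rewrite ler_pM2l // mulr_gt0.
Qed.

End LipschitzGradient.

(** * Convex hulls *)

Section Caratheodory.
Variables (R : realType) (n : nat).
Local Notation V := 'rV[R]_n.
Implicit Types (A : set V) (v : V).

(** Fixing the number of points, with repetitions and zero weights allowed, makes it possible to
    match them with [m] samples or to pass to the limit index by index. *)
Definition convk A k v := exists (l : 'I_k -> R) (a : 'I_k -> V),
  [/\ forall i, 0 <= l i, forall i, A (a i), \sum_i l i = 1 & v = \sum_i l i *: a i].

Lemma convk_conv A k v : convk A k v -> conv A v.
Proof.
move=> [l [a [l0 Aa l1 ->]]]; exists [seq (l i, a i) | i <- index_enum 'I_k].
rewrite !big_map /=; split; last by rewrite l1.
by move=> p /mapP[i _ ->] /=; split.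
Qed.

Lemma conv_convk A v : conv A v -> exists k, convk A k v.
Proof.
move=> [s [hs [s1 ->]]]; exists (size s).
exists (fun i => (tnth (in_tuple s) i).1), (fun i => (tnth (in_tuple s) i).2).
split; last by rewrite [in LHS](big_tnth _ _ s).
- by move=> i; have [] := hs _ (mem_tnth i (in_tuple s)).
- by move=> i; have [] := hs _ (mem_tnth i (in_tuple s)).
- by rewrite -s1 [in RHS](big_tnth _ _ s).
Qed.

(** Appending a column of ones gives a matrix with more rows than its [n + 1] columns. A nonzero
    kernel row has coordinates of sum 0, so one of them is positive. *)
Lemma affine_dependence k (a : 'I_k -> V) : (n.+1 < k)%N ->
  exists mu : 'I_k -> R,
    [/\ exists i, 0 < mu i, \sum_i mu i = 0 & \sum_i mu i *: a i = 0].
Proof.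
move=> nk; pose M := row_mx (\matrix_(i < k) a i) (const_mx 1 : 'M[R]_(k, 1)).
pose w := nz_row (kermx M).
have w0 : w != 0.
  rewrite nz_row_eq0 -mxrank_eq0 mxrank_ker -lt0n subn_gt0.
  by apply: leq_ltn_trans (rank_leq_col M) _; rewrite addn1.
have wM : w *m M = 0 by apply/sub_kermxP; exact: nz_row_sub.
move: wM; rewrite mul_mx_row => /eqP; rewrite row_mx_eq0 => /andP[/eqP wa /eqP w1].
have sum0 : \sum_i w ord0 i = 0.
  have := congr1 (fun B : 'M[R]_(1, 1) => B ord0 ord0) w1; rewrite !mxE => h; rewrite -[RHS]h.
  by apply: eq_bigr => i _; rewrite mxE mulr1.
exists (w ord0); split => //.
  apply: contrapT => /forallNP wle.
  move/eqP: w0; apply; apply/rowP => i; rewrite mxE.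
  have {wle}wle (j : 'I_k) : 0 <= - (w ord0 j) by rewrite oppr_ge0 leNgt; exact/negP/wle.
  have : \sum_j - (w ord0 j) = 0 by rewrite sumrN sum0 oppr0.
  move/psumr_eq0P => h; apply/eqP; rewrite -oppr_eq0; apply/eqP.
  exact: h.
rewrite -[RHS]wa mulmx_sum_row; apply: eq_bigr => i _.
by rewrite rowK.
Qed.

Lemma convk_reduce A k v : (n.+1 <= k)%N -> convk A k.+1 v -> convk A k v.
Proof.
move=> nk [l [a [l0 Aa l1 ->]]].
have [mu [[i1 mu1] mu_sum mu_a]] := affine_dependence a (nk : (n.+1 < k.+1)%N).
(* Subtracting [c * mu] from the weights until the first one vanishes keeps the others nonnegative;
   the minimal ratio tells which one that is. *)
pose i0 := Order.arg_min i1 (fun i => 0 < mu i) (fun i => l i / mu i).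
have [mu0 hmin] : 0 < mu i0 /\ forall i, 0 < mu i -> l i0 / mu i0 <= l i / mu i.
  by rewrite /i0; case: Order.TotalTheory.arg_minP.
pose c := l i0 / mu i0; pose l' i := l i - c * mu i.
have l'0 i : 0 <= l' i.
  rewrite subr_ge0; have [mui|mui] := ltP 0 (mu i).
    by rewrite -ler_pdivlMr //; exact: hmin.
  by apply: le_trans (l0 i); rewrite mulr_ge0_le0 // divr_ge0 // ltW.
have l'i0 : l' i0 = 0 by rewrite /l' /c divfK ?subrr // gt_eqF.
have l'1 : \sum_i l' i = 1.
  by rewrite sumrB l1 -mulr_sumr mu_sum mulr0 subr0.
have l'a : \sum_i l' i *: a i = \sum_i l i *: a i.
  under eq_bigr do rewrite scalerBl -scalerA.
  by rewrite sumrB -scaler_sumr mu_a scaler0 subr0.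
exists (l' \o lift i0), (a \o lift i0); split => //=.
- by rewrite -l'1 (bigD1_ord i0) //= l'i0 add0r.
- by rewrite -l'a (bigD1_ord i0) //= l'i0 scale0r add0r.
Qed.

Lemma convk_widen A k k' v : (k <= k')%N -> convk A k v -> convk A k' v.
Proof.
move=> /subnK <-; elim: (k' - k)%N => // j IH /IH[l [a [l0 Aa l1 ->]]].
(* The padding points get weight 0 but must still belong to [A]; weights of sum 1 cannot form an
   empty family. *)
have [a0 Aa0] : A !=set0.
  case: (j + k)%N l a l0 Aa l1 => [l a _ _|q l a _ Aa _].
    by rewrite big_ord0 => /esym/eqP; rewrite oner_eq0.
  by exists (a ord0).
exists (fun i => oapp l 0 (unlift ord0 i)), (fun i => oapp a a0 (unlift ord0 i)); split.
- by move=> i; case: unliftP => //=.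
- by move=> i; case: unliftP => //=.
- rewrite big_ord_recl unlift_none /= add0r -l1.
  by apply: eq_bigr => i _; rewrite liftK.
- rewrite big_ord_recl unlift_none /= scale0r add0r.
  by apply: eq_bigr => i _; rewrite liftK.
Qed.

Lemma caratheodory A v m : (n.+1 <= m)%N -> conv A v -> convk A m v.
Proof.
move=> nm /conv_convk[k Ak]; apply: convk_widen nm _.
elim: k Ak => [|k IH] Ak; first exact: convk_widen Ak.
have [kn|kn] := leqP k n; first exact: convk_widen Ak.
exact/IH/convk_reduce.
Qed.

Lemma conv_sub A v : A v -> conv A v.
Proof.
move=> Av; apply: (@convk_conv _ 1); exists (fun=> 1), (fun=> v); split => //.
  by rewrite big_ord1.
by rewrite big_ord1 scale1r.
Qed.

Lemma conv_dot_ge A v w c : (forall a, A a -> c <= dot w a) -> conv A v -> c <= dot w v.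
Proof.
move=> hA /conv_convk[k [l [a [l0 Aa l1 ->]]]].
rewrite dot_sumr -[c]mul1r -l1 mulr_suml; apply: ler_sum => i _.
by rewrite dotZr ler_wpM2l // hA.
Qed.

Lemma conv_convex A v w t : 0 <= t <= 1 -> conv A v -> conv A w ->
  conv A ((1 - t) *: v + t *: w).
Proof.
move=> /andP[t0 t1] [s [hs [s1 ->]]] [s' [hs' [s'1 ->]]].
exists ([seq ((1 - t) * p.1, p.2) | p <- s] ++ [seq (t * p.1, p.2) | p <- s']).
split => [p|].
  rewrite mem_cat => /orP[] /mapP[q qs ->] /=.
    by have [q0 Aq] := hs _ qs; split => //; rewrite mulr_ge0 // subr_ge0.
  by have [q0 Aq] := hs' _ qs; split => //; rewrite mulr_ge0.
rewrite !big_cat !big_map /= -!mulr_sumr s1 s'1 !mulr1 subrK; split => //.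
by rewrite !scaler_sumr; congr (_ + _); apply: eq_bigr => i _; rewrite scalerA.
Qed.

End Caratheodory.

(** * Lebesgue outer measure and the uniform law *)

Section OuterMeasure.
Variables (R : realType) (n : nat).
Local Notation V := 'rV[R]_n.
Implicit Types (A B : set V).

Lemma leb_outer_ge0 A : (0 <= leb_outer A)%E.
Proof.
apply: le_ereal_inf_tmp => _ [a [b [ab [_ ->]]]]; apply: nneseries_ge0 => k _ _.
by rewrite lee_fin; apply: prodr_ge0 => i _; rewrite subr_ge0 ab.
Qed.

Lemma leb_outer_mono A B : A `<=` B -> (leb_outer A <= leb_outer B)%E.
Proof.
move=> AB; apply: ereal_inf_le_tmp => _ [a [b [ab [Bab ->]]]].
by exists a, b; split => //; split => //; exact: subset_trans Bab.
Qed.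

(** Covering boxes are mapped to covering boxes. This one inequality suffices later, because the
    inverse map has the same form. *)
Lemma leb_outer_affine c r A : 0 < r ->
  (leb_outer [set (c + r *: y)%R | y in A] <= (r ^+ n)%:E * leb_outer A)%E.
Proof.
move=> r0; rewrite -lee_pdivrMl ?exprn_gt0 //.
apply: le_ereal_inf_tmp => _ [a [b [ab [Aab ->]]]].
rewrite lee_pdivrMl ?exprn_gt0 // -nneseriesZl; last first.
  by move=> k _; rewrite lee_fin; apply: prodr_ge0 => i _; rewrite subr_ge0 ab.
apply: ereal_inf_lbound.
exists (fun k => c + r *: a k), (fun k => c + r *: b k); split.
  by move=> k i; rewrite !mxE lerD2l ler_pM2l.
split.
  move=> _ [y Ay <-]; have [k _ hk] := Aab _ Ay; exists k => // i.
  by rewrite !mxE !lerD2l !ler_pM2l //; exact: hk.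
apply: eq_eseriesr => k _; rewrite -EFinM; congr _%:E.
rewrite /boxvol -[X in r ^+ X](card_ord n) -prodr_const -big_split /=.
by apply: eq_bigr => i _; rewrite !mxE; ring.
Qed.

Lemma borelV_open A : open A -> borelV A.
Proof. by move=> oA; exact: sub_gen_smallest. Qed.

Lemma borelV_setC A : borelV A -> borelV (~` A).
Proof.
by move=> bA; rewrite -setTD; have [_ + _] := smallest_sigma_algebra setT [set U : set V | open U]; exact.
Qed.

Lemma borelV_closed A : closed A -> borelV A.
Proof.
move=> cA; have h : borelV (~` A) by apply: borelV_open; exact: closed_openC.
by rewrite -[A]setCK; exact: borelV_setC.
Qed.

Lemma open_affine c r A : open A -> open [set u : V | A (c + r *: u)].
Proof.
move=> /open_enormP oA; apply/open_enormP => u /= /oA[e e0 he].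
have r1 : 0 < `|r| + 1 by rewrite ltr_wpDl.
exists (e / (`|r| + 1)); first exact: divr_gt0.
move=> y; rewrite ltr_pdivlMr // => yu; apply: he.
rewrite opprD addrACA subrr add0r -scalerBr enormZ; apply: le_lt_trans yu.
by rewrite mulrC ler_wpM2l ?enorm_ge0 // lerDl.
Qed.

End OuterMeasure.

Section UniformLaw.
Variables (R : realType) (n : nat) (d : measure_display) (T : measurableType d)
  (P : probability T R) (U : T -> 'rV[R]_n).
Hypotheses (rU : random_vector U) (uU : uniform_unit_ball P U).
Local Notation V := 'rV[R]_n.
Local Notation B1 := (eball (0 : V) 1).
Implicit Types (A : set V).

Lemma probE (F : set T) : measurable F -> P F = (prob P F)%:E.
Proof. by move=> mF; rewrite fineK // fin_num_measure. Qed.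

(** The whole space has probability 1, so the denominator of the uniform law is nonzero. As [fine]
    sends infinite values to 0, the volume is finite and positive without being computed. *)
Lemma leb_unit_ball_fine : leb_outer B1 = (fine (leb_outer B1))%:E /\ 0 < fine (leb_outer B1).
Proof.
have L0 : fine (leb_outer B1) != 0.
  have := uU (borelV_open openT); rewrite preimage_setT /prob probability_setT /=.
  move=> /eqP; apply: contraTN => /eqP ->.
  by rewrite invr0 mulr0 oner_eq0.
split; first by move: L0; case: (leb_outer B1) => //=; rewrite eqxx.
by rewrite lt0r L0 fine_ge0 // leb_outer_ge0.
Qed.

Let L := fine (leb_outer B1).

Lemma uniform_lawE A : borelV A ->
  P (U @^-1` A) = (L^-1%:E * leb_outer (A `&` B1))%E.
Proof.
have [LE L0] := leb_unit_ball_fine.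
move=> bA; rewrite (probE (rU bA)) (uU bA) mulrC EFinM fineK //.
rewrite ge0_fin_numE ?leb_outer_ge0 //.
apply: le_lt_trans (leb_outer_mono (@subIsetr _ _ _)) _.
by rewrite LE ltry.
Qed.

(** The uniform law on a ball has density at most the ratio of volumes with respect to the uniform
    law on any larger ball containing it. *)
Lemma uniform_law_dominated p rho z r A : 0 < rho -> 0 < r ->
  eball p rho `<=` eball z r -> open A ->
  (P [set w | A (p + rho *: U w)%R] <=
    ((r / rho) ^+ n)%:E * P [set w | A (z + r *: U w)%R])%E.
Proof.
move=> rho0 r0 sub oA; have [LE L0] := leb_unit_ball_fine.
have bo c s := borelV_open (@open_affine _ _ c s _ oA).
rewrite (uniform_lawE (bo p rho)) (uniform_lawE (bo z r)) muleCA.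
rewrite lee_pmul2l // ?lte_fin ?invr_gt0 //.
(* The map [u' |-> c + (r / rho) *: u'] turns coordinates relative to the larger ball into
   coordinates relative to the smaller one. *)
pose c := rho^-1 *: (z - p).
apply: le_trans (leb_outer_affine c _ (divr_gt0 r0 rho0)).
apply: leb_outer_mono => u [Au u1]; exists (r^-1 *: (p + rho *: u - z)).
  split => /=; first by rewrite scalerA divff ?gt_eqF // scale1r addrC subrK.
  rewrite /eball /= subr0 enormZ gtr0_norm ?invr_gt0 // mulrC ler_pdivrMr // mul1r.
  apply: sub; rewrite /eball /= addrC addKr enormZ gtr0_norm //.
  by move: u1; rewrite /eball /= subr0 -(ler_pM2l rho0) mulr1.
rewrite scalerA mulrAC divff ?gt_eqF // mul1r /c -scalerDr.
rewrite (_ : _ + _ = rho *: u) ?scalerA ?mulVf ?gt_eqF ?scale1r //.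
by apply/rowP => i; rewrite !mxE; ring.
Qed.

Lemma uniform_small_ball_gt0 c r : 0 < r -> eball c r `<=` B1 ->
  (0 < P [set w | (enorm (U w - c) < r)%R])%E.
Proof.
move=> r0 sub; have [LE L0] := leb_unit_ball_fine.
rewrite (uniform_lawE (borelV_open (@open_eball _ _ c r))).
rewrite mule_gt0 ?lte_fin ?invr_gt0 // lt_neqAle leb_outer_ge0 andbT eq_sym.
apply/negP => /eqP A0.
(* Were the small ball null, so would be its dilation by [2 / r]. The factor 2 lets an open ball
   cover the closed unit ball. *)
have r2 : 0 < 2 / r by rewrite divr_gt0.
have := leb_outer_affine (- ((2 / r) *: c)) ([set y | enorm (y - c) < r] `&` B1) r2.
rewrite A0 mule0 leNgt => /negP; apply.
apply: (lt_le_trans _ (@leb_outer_mono _ _ B1 _ _)); first by rewrite LE lte_fin; exact: L0.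
move=> u; rewrite /eball /= subr0 => u1; exists (c + (r / 2) *: u).
  have uc : enorm (c + (r / 2) *: u - c) = (r / 2) * enorm u.
    by rewrite addrC addKr enormZ gtr0_norm // divr_gt0.
  have : (r / 2) * enorm u <= r / 2 by rewrite ler_piMr // divr_ge0 // ltW.
  by split; [rewrite /= uc; lra | apply: sub; rewrite /eball /= uc; lra].
rewrite scalerDr addKr scalerA.
by rewrite (_ : 2 / r * (r / 2) = 1) ?scale1r //; field; exact: lt0r_neq0.
Qed.

Lemma uniform_in_unit_ball : P [set w | ~ B1 (U w)] = 0%E.
Proof.
have bB : borelV B1 by apply: borelV_closed; exact: closed_eball.
have [LE L0] := leb_unit_ball_fine.
have PB : P (U @^-1` B1) = 1%E.
  by rewrite (uniform_lawE bB) setIid LE -EFinM mulVf // gt_eqF.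
have := probability_setC P (rU bB); rewrite PB subee // => <-.
Qed.

Lemma uniform_null D z r : 0 < r -> open D -> lebesgue_null (~` D) ->
  P [set w | ~ D (z + r *: U w)] = 0%E.
Proof.
move=> r0 oD nD; have [LE L0] := leb_unit_ball_fine.
have bD : borelV (~` [set u : V | D (z + r *: u)]).
  by apply: borelV_setC; apply: borelV_open; exact: open_affine.
suff H : leb_outer (~` [set u : V | D (z + r *: u)] `&` B1) = 0%E.
  by have := uniform_lawE bD; rewrite H mule0.
apply/eqP; rewrite eq_le leb_outer_ge0 andbT.
have ri : 0 < r^-1 by rewrite invr_gt0.
have := leb_outer_affine (- (r^-1 *: z)) (~` D) ri.
rewrite (nD : leb_outer (~` D) = 0%E) mule0; apply: le_trans.
apply: leb_outer_mono => u [Du _]; exists (z + r *: u) => //.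
by rewrite scalerDr addKr scalerA mulVf ?gt_eqF // scale1r.
Qed.

(** Continuity from above: on the support of the law, the intersection of the [A k] avoids [D] and
    hence has probability 0. *)
Lemma uniform_shrinking D z r (A : nat -> set V) e :
  0 < r -> open D -> lebesgue_null (~` D) -> 0 < e ->
  (forall k, open (A k)) -> (forall k l, (k <= l)%N -> A l `<=` A k) ->
  (forall y, eball z r y -> (forall k, A k y) -> ~ D y) ->
  exists k, (P [set w | A k (z + r *: U w)%R] < e%:E)%E.
Proof.
move=> r0 oD nD e0 oA dA AD.
pose F k := [set w | A k (z + r *: U w)].
have mF k : measurable (F k) by apply: (rU (A := [set u | A k (z + r *: u)])); apply: borelV_open; exact: open_affine.
have mIF : measurable (\bigcap_k F k) by exact: bigcapT_measurable.
have F0 : P (\bigcap_k F k) = 0%E.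
  apply/eqP; rewrite eq_le measure_ge0 andbT.
  have mD : measurable [set w | ~ D (z + r *: U w)].
    apply: (rU (A := ~` [set u | D (z + r *: u)])).
    by apply: borelV_setC; apply: borelV_open; exact: open_affine.
  have mB : measurable [set w | ~ B1 (U w)].
    apply: (rU (A := ~` B1)).
    by apply: borelV_setC; apply: borelV_closed; exact: closed_eball.
  rewrite -[leRHS]adde0 -[X in (X + _)%E](uniform_null z r0 oD nD) -[X in (_ + X)%E]uniform_in_unit_ball.
  apply: le_trans (measureU2 _ mD mB).
  apply: le_measure; [exact: mem_set|by apply: mem_set; exact: measurableU|].
  move=> w Fw /=; have [uB|] := pselect (B1 (U w)); last by right.
  left; apply: AD => [|k]; last exact: Fw.
  rewrite /eball /= addrC addKr enormZ gtr0_norm //; apply: ler_piMr; first exact: ltW.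
  by move: uB; rewrite /eball /= subr0.
have : P \o F @ \oo --> P (\bigcap_k F k).
  apply: nonincreasing_cvg_mu => //.
    by apply: le_lt_trans (probability_le1 _ (mF 0%N)) _; rewrite ltry.
  by move=> k l kl; apply/subsetPset => w; exact: dA.
rewrite F0 => h.
have /h [k _ /(_ k) /=] : nbhs 0%E [set y : \bar R | (y < e%:E)%E].
  by apply: open_nbhs_nbhs; split; [exact: open_ereal_lt_ereal|rewrite /= lte_fin].
by rewrite leqnn => /(_ isT); exists k.
Qed.

End UniformLaw.

(** * A mean value bound outside a null set *)

Section Averaging.
Context (R : realType) (d : measure_display) (T : measurableType d) (P : probability T R).

(** The expected number of events that occur is at most [M * eta], so this number cannot be at least
    [M * c] everywhere. *)
Lemma ex_few_events M (F : 'I_M -> set T) (eta c : R) : (0 < M)%N -> eta < c ->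
  (forall i, measurable (F i)) -> (forall i, (P (F i) <= eta%:E)%E) ->
  exists w, \sum_(i < M) (\1_(F i) w : R) < M%:R * c.
Proof.
move=> M0 etac mF PF; apply: contrapT => /forallNP hw.
have intc (r : R) : (\int[P]_w r%:E)%E = r%:E.
  by rewrite (integral_cst P measurableT r%:E) [X in (_ * X)%E](_ : _ = 1%E) ?mule1 //; exact: probability_setT.
have le1 : (\int[P]_w (M%:R * c)%:E <= \int[P]_w (\sum_(i < M) (\1_(F i) w)%:E))%E.
  have [c0|c0] := leP 0 c; last first.
    apply: (@le_trans _ _ 0%E).
      rewrite intc lee_fin.
      by rewrite mulr_ge0_le0 // ltW.
    by apply: integral_ge0 => w _; apply: sume_ge0 => i _; rewrite lee_fin indicE.
  apply: ge0_le_integral => //.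
  - by move=> w _; rewrite lee_fin mulr_ge0.
  - apply: emeasurable_sum => i; apply/measurable_EFinP.
    exact: measurable_indic.
  - by move=> w _; rewrite sumEFin lee_fin leNgt; exact/negP/hw.
have : (\int[P]_w (\sum_(i < M) (\1_(F i) w)%:E) <= (M%:R * eta)%:E)%E.
  rewrite ge0_integral_sum //.
  - have -> : (M%:R * eta)%:E = (\sum_(i < M) eta%:E)%E.
      by rewrite sumEFin sumr_const card_ord mulr_natl.
    apply: lee_sum => i _; rewrite integral_indic // setIT; exact: PF.
  - by move=> i; apply/measurable_EFinP; exact: measurable_indic.
move=> /(le_trans le1); rewrite intc lee_fin.
by rewrite ler_pM2l ?ltr0n // leNgt etac.
Qed.

End Averaging.

Section MeanValueBound.
Variables (R : realType) (n : nat) (d : measure_display) (T : measurableType d)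
  (P : probability T R) (U : T -> 'rV[R]_n).
Hypotheses (rU : random_vector U) (uU : uniform_unit_ball P U).
Local Notation V := 'rV[R]_n.
Local Notation B1 := (eball (0 : V) 1).
Variables (f : V -> R) (D : set V).
Hypotheses (fL : locally_lipschitz f) (oD : open D) (nD : lebesgue_null (~` D))
  (fD : forall x, D x -> differentiable f x).

Lemma locally_lipschitz_near (x : V) (e : R) : 0 < e ->
  exists2 r, 0 < r & forall y, enorm (y - x) < r -> `|f y - f x| < e.
Proof.
move=> e0; have [L L0 hL] := locally_lipschitz_uniform fL (@compact_eball R n x 0).
have xx : eball x 0 x by rewrite /eball /= subrr enorm0.
exists (Num.min L^-1 (e / L)); first by rewrite lt_min invr_gt0 L0 divr_gt0.
move=> y; rewrite lt_min => /andP[y1 y2]; apply: le_lt_trans (hL x y xx (ltW y1)) _.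
by rewrite mulrC -ltr_pdivlMr.
Qed.

Lemma open_increment_gt v (a b : R) : open [set y : V | b < a * (f (y + v) - f y)].
Proof.
apply/open_enormP => y /= by_.
pose e := (a * (f (y + v) - f y) - b) / (2 * (`|a| + 1)).
have a1 : 0 < `|a| + 1 by rewrite ltr_wpDl.
have e0 : 0 < e by rewrite divr_gt0 ?mulr_gt0 // subr_gt0.
have [r1 r10 h1] := locally_lipschitz_near y e0.
have [r2 r20 h2] := locally_lipschitz_near (y + v) e0.
exists (Num.min r1 r2); first by rewrite lt_min r10.
move=> y'; rewrite lt_min => /andP[/h1 k1 yr2].
have /h2 k2 : enorm (y' + v - (y + v)) < r2 by rewrite opprD addrACA subrr addr0.
have k3 : `|(f (y' + v) - f y') - (f (y + v) - f y)| < 2 * e.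
  rewrite (_ : _ - _ = (f (y' + v) - f (y + v)) - (f y' - f y)); last by ring.
  by apply: le_lt_trans (ler_normB _ _) _; lra.
have : `|a * (f (y' + v) - f y') - a * (f (y + v) - f y)| < a * (f (y + v) - f y) - b.
  rewrite -mulrBr normrM.
  apply: (@le_lt_trans _ _ (`|a| * (2 * e))); first by rewrite ler_wpM2l // ltW.
  have -> : a * (f (y + v) - f y) - b = (`|a| + 1) * (2 * e).
    by rewrite /e; field; exact: lt0r_neq0.
  by rewrite ltr_pM2r; lra.
rewrite ltr_norml => /andP[+ _]; lra.
Qed.

(* The bad starting points of steps of length at most 1/N form open sets shrinking
   to a null set; as a uniform point of a small ball translated along the segment is
   dominated by one fixed uniform law, few steps are bad on average, so some
   parallel segment has few bad steps. *)
Lemma increment_le_of_grad_le (z p v : V) (r k : R) :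
  enorm (p - z) < r -> enorm (p + v - z) < r ->
  (forall y, D y -> enorm (y - z) < r -> dot (grad f y) v <= k) ->
  f (p + v) - f p <= k.
Proof.
move=> pz pvz hk; apply/ler_addgt0Pr => e e0; rewrite leNgt; apply/negP => big.
(* By convexity [m0] bounds the distance from [z] along the segment. Taking [r'] strictly between
   [m0] and [r] leaves room for a tube around the segment. *)
pose m0 := Num.max (enorm (p - z)) (enorm (p + v - z)).
have m0r : m0 < r by rewrite gt_max pz.
have m00 : 0 <= m0 by rewrite le_max enorm_ge0.
pose r' := (m0 + r) / 2.
have m0r' : m0 < r' by rewrite /r'; lra.
have r'r : r' < r by rewrite /r'; lra.
have r'0 : 0 < r' by lra.
have [L L0 hL] := locally_lipschitz_uniform fL (@compact_eball R n z r').
(* The three bounds keep the tube in the ball of radius [r'], make the Lipschitz estimate available,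
   and limit the effect of a translation on [f] to [e / 5]. *)
pose rho := Num.min (r' - m0) (Num.min L^-1 (e / 5 / L)).
have rho0 : 0 < rho.
  by rewrite !lt_min subr_gt0 m0r' invr_gt0 L0 !divr_gt0.
have rho1 : rho <= r' - m0 by rewrite ge_min lexx.
have rho2 : rho <= L^-1 by rewrite !ge_min lexx !orbT.
have rho3 : L * rho <= e / 5 by rewrite mulrC -ler_pdivlMr // !ge_min lexx !orbT.
have seg s : 0 <= s <= 1 -> enorm (p + s *: v - z) <= m0.
  move=> /andP[s0 s1].
  have -> : p + s *: v - z = (1 - s) *: (p - z) + s *: (p + v - z).
    by apply/rowP => i; rewrite !mxE; ring.
  apply: le_trans (ler_enormD _ _) _; rewrite !enormZ !ger0_norm ?subr_ge0 //.
  have a1 : enorm (p - z) <= m0 by rewrite le_max lexx.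
  have a2 : enorm (p + v - z) <= m0 by rewrite le_max lexx orbT.
  have -> : m0 = (1 - s) * m0 + s * m0 by ring.
  by rewrite lerD // ler_wpM2l // subr_ge0.
have tube s : 0 <= s <= 1 -> eball (p + s *: v) rho `<=` eball z r'.
  move=> s01 y; rewrite /eball /= => yr.
  by have := ler_enormB_trans (p + s *: v) y z; have := seg s s01; lra.
(* These are the starting points of some step [v / M], with [N <= M], of slope above [k + e / 5]. At
   a point of [D] near [z], short steps have slope at most [k + e / 10], so that point leaves [A N]
   for large [N]. *)
pose A N := \bigcup_(M in [set M | (N <= M)%N])
  [set y : V | k + e / 5 < M%:R * (f (y + M%:R^-1 *: v) - f y)].
have oA N : open (A N).
  by apply: bigcup_open => M _; exact: (@open_increment_gt (M%:R^-1 *: v) M%:R (k + e / 5)).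
(* [C] covers the excess over [k] of the Lipschitz bound on a bad step, and [c] is chosen so that
   [C * c = 2 * e / 5]. *)
pose C := L * enorm v + `|k| + e.
have C0 : 0 < C.
  by rewrite ltr_wpDl // addr_ge0 // mulr_ge0 ?enorm_ge0 // ltW.
pose c := 2 * e / 5 / C.
have c1 : c <= 1.
  have : 0 <= L * enorm v by rewrite mulr_ge0 ?enorm_ge0 // ltW.
  by rewrite /c ler_pdivrMr // mul1r /C; have := normr_ge0 k; lra.
have c0 : 0 < c by rewrite !divr_gt0 ?mulr_gt0.
pose Q := (r' / rho) ^+ n.
have Q0 : 0 < Q by rewrite exprn_gt0 // divr_gt0.
have [N PN] : exists N, (P [set w | A N (z + r' *: U w)%R] < (c / 2 / Q)%:E)%E.
  have cQ : 0 < c / 2 / Q by apply: divr_gt0 => //; apply: divr_gt0.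
  apply: (uniform_shrinking rU uU r'0 oD nD cQ).
  - exact: oA.
  - by move=> N1 N2 N12 y [M /= NM hM]; exists M => //=; exact: leq_trans NM.
  - move=> y yz yA Dy.
    have [h0 h00 hh] := grad_expansion v (fD Dy) (divr_gt0 e0 (ltr0n R 10)).
    have [N0 hN0] : exists N0 : nat, h0^-1 < N0%:R.
      by exists (Num.bound h0^-1); apply: archi_boundP; rewrite invr_ge0 ltW.
    have [M /= NM] := yA N0.+1.
    have M0 : 0 < M%:R :> R by rewrite ltr0n; exact: leq_trans NM.
    have Mh0 : M%:R^-1 < h0.
      rewrite -[h0]invrK ltf_pV2 ?posrE ?invr_gt0 //; apply: lt_le_trans hN0 _.
      by rewrite ler_nat ltnW.
    have := hh M%:R^-1; rewrite invr_gt0 M0 Mh0 => /(_ isT).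
    rewrite ler_norml => /andP[_ h1].
    have yr : enorm (y - z) < r by apply: le_lt_trans r'r.
    have := hk y Dy yr => h2.
    have : M%:R * (f (y + M%:R^-1 *: v) - f y) <=
        M%:R * (M%:R^-1 * dot (grad f y) v + e / 10 * M%:R^-1).
      by rewrite ler_pM2l //; lra.
    rewrite [X in _ <= X](_ : _ = dot (grad f y) v + e / 10); last first.
      by field; exact: lt0r_neq0.
    lra.
pose M := (maxn N (Num.bound (L * enorm v))).+1.
have NM : (N <= M)%N by rewrite ltnW // ltnS leq_maxl.
have M0 : 0 < M%:R :> R by rewrite ltr0n.
have Mv : enorm (M%:R^-1 *: v) <= L^-1.
  rewrite enormZ gtr0_norm ?invr_gt0 // mulrC ler_pdivrMr // mulrC ler_pdivlMr //.
  rewrite mulrC; apply: le_trans (ltW (archi_boundP _)) _.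
    by rewrite mulr_ge0 ?enorm_ge0 // ltW.
  by rewrite ler_nat; apply: leqW; exact: leq_maxr.
pose s (i : nat) : R := i%:R / M%:R.
have s01 i : (i <= M)%N -> 0 <= s i <= 1.
  by move=> iM; rewrite divr_ge0 // ler_pdivrMr // mul1r ler_nat.
(* Leaving the unit ball counts as bad at every step. As [c <= 1], an outcome with few bad steps
   therefore stays in the tube. *)
pose F (i : 'I_M) := [set w | A N (p + s i *: v + rho *: U w)] `|` [set w | ~ B1 (U w)].
have mA q a : measurable [set w | A N (q + a *: U w)].
  by apply: (rU (A := [set u | A N (q + a *: u)])); apply: borelV_open; exact: open_affine.
have mB : measurable [set w | ~ B1 (U w)].
  apply: (rU (A := ~` B1)).
  by apply: borelV_setC; apply: borelV_closed; exact: closed_eball.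
have [||i|i|w hw] := @ex_few_events R d T P M F (c / 2) c.
- by [].
- by lra.
- exact: measurableU.
- apply: le_trans (measureU2 _ (mA _ _) mB) _.
  rewrite [X in (_ + X)%E](uniform_in_unit_ball rU uU) adde0.
  have := uniform_law_dominated rU uU rho0 r'0 (tube _ (s01 i (ltnW (ltn_ord i)))) (oA N).
  move=> /le_trans; apply; rewrite -/Q.
  apply: (@le_trans _ _ (Q%:E * (c / 2 / Q)%:E)%E).
    by rewrite lee_pmul2l ?lte_fin // ltW.
  by rewrite -EFinM mulrCA divff ?mulr1 // gt_eqF.
have wB : B1 (U w).
  apply: contrapT => nB; move: hw; rewrite ltNge => /negP; apply.
  rewrite (eq_bigr (fun=> 1)); last first.
    by move=> i _; rewrite indicE mem_set //; right.
  by rewrite sumr_const card_ord -[leRHS]mulr1 ler_pM2l.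
pose q := p + rho *: U w.
have qtube i : (i <= M)%N -> eball z r' (q + s i *: v).
  move=> iM; apply: (tube (s i) (s01 i iM)); rewrite /eball /= /q.
  rewrite (_ : _ - _ = rho *: U w); last by apply/rowP => j; rewrite !mxE; ring.
  rewrite enormZ gtr0_norm //; apply: ler_piMr; first exact: ltW.
  by move: wB; rewrite /eball /= subr0.
have s0 : s 0%N = 0 by rewrite /s mul0r.
have sM : s M = 1 by rewrite /s divff ?gt_eqF.
have ss i : s i.+1 = s i + M%:R^-1 by rewrite /s -addn1 natrD mulrDl mul1r.
have step (i : 'I_M) : M%:R * (f (q + s i.+1 *: v) - f (q + s i *: v)) <=
    k + e / 5 + C * \1_(F i) w.
  have -> : q + s i.+1 *: v = q + s i *: v + M%:R^-1 *: v.
    by rewrite ss scalerDl addrA.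
  have [Fw|Fw] := pselect (F i w).
    rewrite indicE mem_set // mulr1.
    have vv : q + s i *: v + M%:R^-1 *: v - (q + s i *: v) = M%:R^-1 *: v.
      by rewrite addrC addKr.
    have := hL _ (q + s i *: v + M%:R^-1 *: v) (qtube i (ltnW (ltn_ord i))).
    have nv : enorm (M%:R^-1 *: v) = M%:R^-1 * enorm v by rewrite enormZ gtr0_norm ?invr_gt0.
    rewrite vv => /(_ Mv); rewrite nv ler_norml.
    move=> /andP[_]; rewrite -(ler_pM2l M0) => /le_trans; apply.
    rewrite [leLHS](_ : _ = L * enorm v); last by field; exact: lt0r_neq0.
    by rewrite /C; have := ler_norm (- k); rewrite normrN; lra.
  rewrite indicE memNset // mulr0 addr0 leNgt; apply/negP => bad.
  apply: Fw; left; exists M => //.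
  by rewrite /= (addrAC p).
have tele j : (j <= M)%N -> M%:R * (f (q + s j *: v) - f q) <=
    \sum_(i < M | (i < j)%N) (k + e / 5 + C * \1_(F i) w).
  elim: j => [|j IH] jM.
    by rewrite s0 scale0r addr0 subrr mulr0 big_pred0.
  rewrite (bigD1 (Ordinal jM)) //=.
  rewrite (eq_bigl (fun i : 'I_M => (i < j)%N)); last first.
    by move=> i; rewrite ltnS [RHS]ltn_neqAle andbC.
  have := step (Ordinal jM); have := IH (ltnW jM) => /=.
  by rewrite !mulrBr; lra.
have := tele M (leqnn M); rewrite sM scale1r.
rewrite (eq_bigl xpredT); last by move=> i; rewrite ltn_ord.
rewrite big_split /= sumr_const card_ord -mulr_sumr => tot.
(* Translating the two endpoints loses at most [2 * e / 5] of the assumed excess [e]. The remaining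
   [3 * e / 5] contradicts the sum of [e / 5] for all steps and less than [2 * e / 5] for the bad
   ones. *)
have lo : M%:R * (k + 3 * e / 5) < M%:R * (f (q + v) - f q).
  rewrite ltr_pM2l //.
  have pB s' : 0 <= s' <= 1 -> `|f (p + s' *: v + rho *: U w) - f (p + s' *: v)| <= e / 5.
    move=> s'01.
    have bp : eball z r' (p + s' *: v).
      by apply: (tube s' s'01); rewrite /eball /= subrr enorm0 ltW.
    have ub : enorm (p + s' *: v + rho *: U w - (p + s' *: v)) <= rho.
      rewrite addrC addKr enormZ gtr0_norm //; apply: ler_piMr; first exact: ltW.
      by move: wB; rewrite /eball /= subr0.
    apply: le_trans (hL _ _ bp (le_trans ub rho2)) _; apply: le_trans rho3.
    by rewrite ler_pM2l.
  have := pB 0; rewrite scale0r addr0 lexx ler01 -/q => /(_ isT).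
  have := pB 1; rewrite scale1r lexx ler01 addrAC -/q => /(_ isT).
  by rewrite !ler_norml => /andP[h1 h2] /andP[h3 h4]; lra.
have hi : C * \sum_(i < M) (\1_(F i) w : R) < M%:R * (2 * e / 5).
  have -> : M%:R * (2 * e / 5) = C * (M%:R * c).
    by rewrite /c; field; exact: lt0r_neq0.
  by rewrite ltr_pM2l.
move: tot lo hi; rewrite -mulr_natl !mulrDr; lra.
Qed.

End MeanValueBound.

(** * Uniform descent near a point *)

Section ConvexGeometry.
Variables (R : realType) (n : nat).
Local Notation V := 'rV[R]_n.
Implicit Types (A : set V) (v w : V).

Lemma conv_enorm_le A v (L : R) : (forall a, A a -> enorm a <= L) -> conv A v -> enorm v <= L.
Proof.
move=> hA /conv_convk[k [l [a [l0 Aa l1 ->]]]].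
apply: le_trans (ler_enorm_sum _ _) _; rewrite -[L]mul1r -l1 mulr_suml.
by apply: ler_sum => i _; rewrite enormZ ger0_norm // ler_wpM2l // hA.
Qed.

Lemma sqr_enormD v w : enorm (v + w) ^+ 2 = enorm v ^+ 2 + 2 * dot v w + enorm w ^+ 2.
Proof. by rewrite !sqr_enorm !(dotDl, dotDr) (dotC w v); ring. Qed.

(** Approximate form of the variational inequality for projections: moving from [w] towards [v] by a
    fraction [t] cannot bring the norm below [rho], and [s] absorbs both the defect of [w] and the
    quadratic term. *)
Lemma near_minimal_dot A w v (rho L t s : R) :
  0 <= rho -> (forall u, conv A u -> rho <= enorm u) -> conv A w -> A v ->
  0 < t <= 1 -> enorm w ^+ 2 <= rho ^+ 2 + t * s -> 4 * t * L ^+ 2 <= s ->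
  enorm w <= L -> enorm v <= L -> rho ^+ 2 - s <= dot w v.
Proof.
move=> rho0 hrho Aw Av /andP[t0 t1] wrho tL wL vL.
have /hrho h : conv A ((1 - t) *: w + t *: v).
  by apply: conv_convex => //; [rewrite ltW|exact: conv_sub].
have {}h : rho ^+ 2 <= enorm (w + t *: (v - w)) ^+ 2.
  rewrite ler_pXn2r ?nnegrE ?enorm_ge0 //; apply: le_trans h _.
  rewrite le_eqVlt; apply/orP; left; apply/eqP; congr enorm.
  by apply/rowP => i; rewrite !mxE; ring.
have vw : enorm (v - w) ^+ 2 <= 4 * L ^+ 2.
  have : enorm (v - w) <= 2 * L.
    by apply: le_trans (ler_enormD _ _) _; rewrite enormN; lra.
  rewrite -(@ler_pXn2r _ 2%N) ?nnegrE ?enorm_ge0 //; first by move=> /le_trans; apply; rewrite exprMn; lra.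
  by rewrite mulr_ge0 // (le_trans (enorm_ge0 _) vL).
move: h; rewrite sqr_enormD enormZ exprMn real_normK ?num_real // dotZr dotDr dotNr -sqr_enorm => h.
have h2 : t ^+ 2 * enorm (v - w) ^+ 2 <= t * s.
  apply: (@le_trans _ _ (t ^+ 2 * (4 * L ^+ 2))); first by rewrite ler_wpM2l ?sqr_ge0.
  have -> : t ^+ 2 * (4 * L ^+ 2) = t * (4 * t * L ^+ 2) by ring.
  by rewrite ler_pM2l.
have h3 : 0 <= t * (dot w v - enorm w ^+ 2 + s) by lra.
rewrite pmulr_rge0 // in h3.
have : rho ^+ 2 <= enorm w ^+ 2 by rewrite ler_pXn2r ?nnegrE ?enorm_ge0 // hrho.
lra.
Qed.

Lemma finite_pos_lower_bound (I : finType) (e : I -> R) : (forall i, 0 < e i) ->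
  exists2 e0, 0 < e0 & forall i, e0 <= e i.
Proof.
move=> e0; exists (\big[Num.min/1]_i e i); first by apply: lt_bigmin.
by move=> i; exact: bigmin_le_cond.
Qed.

End ConvexGeometry.

Section LocalDescent.
Variables (R : realType) (n : nat) (d : measure_display) (T : measurableType d)
  (P : probability T R) (U : T -> 'rV[R]_n).
Hypotheses (rU : random_vector U) (uU : uniform_unit_ball P U).
Local Notation V := 'rV[R]_n.
Local Notation B1 := (eball (0 : V) 1).
Variables (f : V -> R) (D : set V).
Hypotheses (fL : locally_lipschitz f) (oD : open D) (nD : lebesgue_null (~` D))
  (fC : C1_on f D).

Lemma conull_dense (z : V) (r : R) : 0 < r -> exists y, D y /\ enorm (y - z) < r.
Proof.
move=> r0; apply: contrapT => /forallNP hy.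
have r2 : 0 < r / 2 by rewrite divr_gt0.
have PD := uniform_null rU uU z r2 oD nD.
have PB := uniform_in_unit_ball rU uU.
have mD : measurable [set w | ~ D (z + (r / 2) *: U w)].
  apply: (rU (A := ~` [set u | D (z + (r / 2) *: u)])).
  by apply: borelV_setC; apply: borelV_open; exact: open_affine.
have mB : measurable [set w | ~ B1 (U w)].
  apply: (rU (A := ~` B1)).
  by apply: borelV_setC; apply: borelV_closed; exact: closed_eball.
have := measureU2 P mD mB; rewrite [X in (_ <= X + _)%E]PD [X in (_ <= _ + X)%E]PB adde0 (_ : _ `|` _ = setT).
  by rewrite [X in (X <= _)%E]probability_setT lee_fin ler10.
apply/seteqP; split => // w _; have [uB|] := pselect (B1 (U w)); last by right.
left => /= Dw; apply: (hy (z + (r / 2) *: U w)); split => //.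
rewrite addrC addKr enormZ gtr0_norm //.
apply: (@le_lt_trans _ _ (r / 2)); last by lra.
by apply: ler_piMr; [exact: ltW|move: uB; rewrite /eball /= subr0].
Qed.

Lemma grad_dot_ge z r x w k :
  enorm (x - z) < r -> differentiable f x ->
  (forall y, D y -> enorm (y - z) < r -> k <= dot w (grad f y)) ->
  k <= dot w (grad f x).
Proof.
move=> xz fx hk; apply/ler_addgt0Pr => e e0.
have [h0 h00 hh] := grad_expansion (- w) fx e0.
pose h1 := (r - enorm (x - z)) / (2 * (enorm w + 1)).
have w1 : 0 < enorm w + 1 by rewrite ltr_wpDl ?enorm_ge0.
have h10 : 0 < h1 by rewrite divr_gt0 ?subr_gt0 ?mulr_gt0.
pose h := Num.min (h0 / 2) h1.
have hp : 0 < h by rewrite lt_min h10 divr_gt0.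
have hlt : h < h0 by rewrite gt_min; apply/orP; left; lra.
have hw : enorm (h *: - w) < r - enorm (x - z).
  rewrite enormZ enormN gtr0_norm //.
  apply: (@le_lt_trans _ _ (h1 * enorm w)).
    by rewrite ler_wpM2r ?enorm_ge0 // ge_min lexx orbT.
  have -> : r - enorm (x - z) = h1 * (2 * (enorm w + 1)).
    by rewrite /h1; field; exact: lt0r_neq0.
  by rewrite ltr_pM2l //; have := enorm_ge0 w; lra.
have h2 : f (x + h *: - w) - f x <= - (h * k).
  apply: (increment_le_of_grad_le rU uU fL oD nD fC.1 (z := z) (r := r)) => //.
    by rewrite addrAC; apply: le_lt_trans (ler_enormD _ _) _; lra.
  move=> y Dy yz; rewrite dotZr dotNr dotC mulrN lerN2 ler_pM2l //.
  exact: hk.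
have := hh h; rewrite hp hlt => /(_ isT); rewrite ler_norml => /andP[+ _].
rewrite dotNr dotC => h3.
have : h * k <= h * (dot w (grad f x) + e) by lra.
by rewrite ler_pM2l.
Qed.

(** The dichotomy is on [rho], the distance from the origin to the convex hull of the gradients over
    [D] near [xb]. If it is small, good samples make [g] small. Otherwise [g] is close to an almost
    shortest element and has a large inner product with every nearby gradient. *)
Lemma local_descent (xb : V) (eps delta beta : R) m :
  0 < eps -> 0 < delta -> 0 < beta < 1 -> (n.+1 <= m)%N ->
  exists tau c0 eta (ys : 'I_m -> V),
   [/\ 0 < tau, 0 < c0, 0 < eta, forall i, eball (ys i) eta `<=` eball xb eps &
    forall x (s : 'I_m -> V) g, enorm (x - xb) < tau -> differentiable f x ->
      (forall i, enorm (s i - ys i) < eta) ->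
      min_norm_elt ([set grad f x] `|` [set grad f (s i) | i in setT]) g ->
      enorm g <= delta \/
      (forall h, 0 < h <= c0 -> f (x - h *: g) < f x - beta * h * enorm g ^+ 2)].
Proof.
move=> eps0 delta0 /andP[beta0 beta1] nm.
have [L L0 hL] := locally_lipschitz_uniform fL (@compact_eball R n xb eps).
have gradL y : enorm (y - xb) < eps -> differentiable f y -> enorm (grad f y) <= L.
  by move=> yx fy; apply: norm_grad_le => // z; apply: hL; exact: ltW.
pose G := [set grad f y | y in [set y | D y /\ enorm (y - xb) < eps]].
have GL v : G v -> enorm v <= L by move=> [y [Dy yx] <-]; apply: gradL => //; exact: fC.1.
have [y0 [Dy0 y0x]] := conull_dense xb eps0.
pose S := [set enorm v | v in conv G].
have S0 : has_inf S.
  split; last by exists 0 => _ [v _ <-]; exact: enorm_ge0.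
  by exists (enorm (grad f y0)); exists (grad f y0) => //; apply: conv_sub; exists y0.
pose rho := inf S.
have rho0 : 0 <= rho by apply: lb_le_inf => [|_ [v _ <-]]; [exact: S0.1|exact: enorm_ge0].
have hrho u : conv G u -> rho <= enorm u.
  by move=> Gu; apply: ge_inf; [exact: S0.2|exists u].
(* An almost shortest [w] combines the gradients at [m] points [ys]. Samples near these points have
   gradients within [a], so the same weights give an element of norm at most [rho + 2 * a], which
   bounds [g]. *)
have sampling a : 0 < a -> exists w eta (ys : 'I_m -> V),
    [/\ conv G w, enorm w <= rho + a, 0 < eta, forall i, eball (ys i) eta `<=` eball xb eps &
     forall s : 'I_m -> V, (forall i, enorm (s i - ys i) < eta) ->
       (forall i, G (grad f (s i))) /\
       forall x g, min_norm_elt ([set grad f x] `|` [set grad f (s i) | i in setT]) g ->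
         enorm g <= rho + 2 * a].
  move=> a0; have [_ [w Gw <-] wa] := inf_adherent a0 S0.
  have [l [b [l0 Gb l1 wE]]] := caratheodory nm Gw.
  have Gb' i : exists y, (D y /\ enorm (y - xb) < eps) /\ grad f y = b i.
    by have [y ? ?] := Gb i; exists y.
  have [ys hys] := choice Gb'.
  have heta i : exists eta, [/\ 0 < eta, eball (ys i) eta `<=` eball xb eps &
      forall s, enorm (s - ys i) < eta ->
        [/\ D s, enorm (s - xb) < eps & enorm (grad f s - b i) < a]].
    have [[Dy yx] yb] := hys i.
    have [e1 e10 h1] := (open_enormP D).1 oD _ Dy.
    have hc : \forall s \near nbhs (ys i), enorm (grad f s - grad f (ys i)) < a.
      have := fC.2 _ Dy; move=> /(cvg_enormP (nbhs_filter (ys i))); exact.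
    have [e2 e20 h2] := (near_enormP (ys i) _).1 hc.
    exists (Num.min (eps - enorm (ys i - xb)) (Num.min e1 e2)); split.
    - by rewrite !lt_min subr_gt0 yx e10.
    - move=> y; rewrite /eball /= !le_min => /andP[yy _].
      by have := ler_enormB_trans (ys i) y xb; lra.
    - move=> s; rewrite !lt_min => /and3P[ss /h1 Ds /h2]; rewrite yb => ha.
      by split => //; have := ler_enormB_trans (ys i) s xb; lra.
  have [etas hetas] := choice heta.
  have [eta eta0 etale] := finite_pos_lower_bound (fun i => let: And3 h _ _ := hetas i in h).
  exists w, eta, ys; split => //.
  - exact: ltW.
  - move=> i y; rewrite /eball /= => yy; have [_ + _] := hetas i; apply.
    exact: le_trans (etale i).
  move=> s hs; have hsi i : [/\ D (s i), enorm (s i - xb) < eps & enorm (grad f (s i) - b i) < a].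
    by have [_ _] := hetas i; apply; apply: lt_le_trans (etale i).
  split=> [i|x g [_ hg]]; first by exists (s i) => //; have [? ? _] := hsi i.
  pose w1 := \sum_i l i *: grad f (s i).
  have /hg : conv ([set grad f x] `|` [set grad f (s i) | i in setT]) w1.
    apply: (@convk_conv _ _ _ m); exists l, (fun i => grad f (s i)); split => //.
    by move=> i; right; exists i.
  move=> /le_trans; apply.
  have -> : w1 = w + \sum_i l i *: (grad f (s i) - b i).
    by rewrite wE -big_split /=; apply: eq_bigr => i _; rewrite -scalerDr addrC subrK.
  apply: le_trans (ler_enormD _ _) _.
  have : enorm (\sum_i l i *: (grad f (s i) - b i)) <= a.
    apply: le_trans (ler_enorm_sum _ _) _; rewrite -[leRHS]mul1r -l1 mulr_suml.
    apply: ler_sum => i _; rewrite enormZ ger0_norm // ler_wpM2l //.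
    by apply: ltW; have [] := hsi i.
  by move: wa; rewrite -/rho; lra.
have [rhod|rhod] := leP rho (delta / 2).
  have [|w [eta [ys [_ _ eta0 etas hs]]]] := sampling (delta / 4); first by rewrite divr_gt0.
  exists 1, 1, eta, ys; split => // x s g _ _ /hs[_ hg] /hg gl; left; lra.
have rhop : 0 < rho by apply: lt_trans rhod; exact: divr_gt0.
(* Constants are chosen backwards: [q] is the error that the gap between [beta] and 1 tolerates, [t]
   serves [near_minimal_dot] with [s = q ^+ 2], and [a] keeps the squares of [rho + a] and
   [rho + 2 * a] within [t * q ^+ 2] of [rho ^+ 2]. *)
pose q := Num.min 1 ((1 - beta) * rho ^+ 2 / (4 * (1 + L))).
have b1 : 0 < 1 - beta by rewrite subr_gt0.
have br : 0 < (1 - beta) * rho ^+ 2 by rewrite mulr_gt0 // exprn_gt0.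
have L1 : 0 < 1 + L by rewrite addr_gt0.
have q0 : 0 < q by rewrite lt_min ltr01 divr_gt0 // mulr_gt0.
have q1 : q <= 1 by rewrite ge_min lexx.
have q2 : 4 * (q * (1 + L)) <= (1 - beta) * rho ^+ 2.
  have : q <= (1 - beta) * rho ^+ 2 / (4 * (1 + L)) by rewrite ge_min lexx orbT.
  by rewrite ler_pdivlMr ?mulr_gt0 //; lra.
have qq : 0 < q ^+ 2 by rewrite exprn_gt0.
have qqq : q ^+ 2 <= q by rewrite expr2 ler_piMr // ltW.
have LL : 0 < L ^+ 2 by rewrite exprn_gt0.
pose t := Num.min 1 (q ^+ 2 / (4 * L ^+ 2)).
have t0 : 0 < t by rewrite lt_min ltr01 divr_gt0 // mulr_gt0.
have t1 : t <= 1 by rewrite ge_min lexx.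
have tL : 4 * t * L ^+ 2 <= q ^+ 2.
  have : t <= q ^+ 2 / (4 * L ^+ 2) by rewrite ge_min lexx orbT.
  by rewrite ler_pdivlMr ?mulr_gt0 //; lra.
have tq : 0 < t * q ^+ 2 by rewrite mulr_gt0.
pose a := Num.min 1 (t * q ^+ 2 / (4 * rho + 4)).
have a0 : 0 < a by rewrite lt_min ltr01 divr_gt0 // addr_gt0 ?mulr_gt0.
have a1 : a <= 1 by rewrite ge_min lexx.
have aq : 4 * a * rho + 4 * a ^+ 2 <= t * q ^+ 2.
  have : a <= t * q ^+ 2 / (4 * rho + 4) by rewrite ge_min lexx orbT.
  rewrite ler_pdivlMr; last by rewrite addr_gt0 ?mulr_gt0.
  have : a ^+ 2 <= a by rewrite expr2 ler_piMr // ltW.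
  lra.
have arho : 0 < a * rho by rewrite mulr_gt0.
have aa : 0 < a ^+ 2 by rewrite exprn_gt0.
have tqq : t * q ^+ 2 <= q ^+ 2 by rewrite ler_piMl // ltW.
have [w [eta [ys [Gw wa eta0 etas hs]]]] := sampling a a0.
have sqle (u : V) (c : R) : enorm u <= c -> enorm u ^+ 2 <= c ^+ 2.
  by move=> uc; rewrite ler_pXn2r ?nnegrE ?enorm_ge0 // (le_trans (enorm_ge0 _) uc).
have wsq : enorm w ^+ 2 <= rho ^+ 2 + t * q ^+ 2.
  by apply: le_trans (sqle _ _ wa) _; rewrite sqrrD; lra.
have wG v : G v -> rho ^+ 2 - q ^+ 2 <= dot w v.
  move=> Gv; apply: (near_minimal_dot (A := G) (L := L) (t := t)) => //.
  - by rewrite t0.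
  - by apply: conv_enorm_le Gw.
  - exact: GL.
pose k := rho ^+ 2 - q ^+ 2 - 2 * q * L.
(* As [enorm g <= rho + 2], an allowed step has length at most [eps / 4]; starting within [eps / 2]
   of [xb], it stays in the [eps]-ball. *)
exists (eps / 2), (eps / (4 * (rho + 2))), eta, ys; split => //.
- exact: divr_gt0.
- by rewrite divr_gt0 // mulr_gt0 // addr_gt0.
move=> x s g xx fx /hs[Gs hg] gmin; have ga := hg _ _ gmin; right.
have xeps : enorm (x - xb) < eps by lra.
have wg : rho ^+ 2 - q ^+ 2 <= dot w g.
  apply: conv_dot_ge (gmin.1) => v [->|[i _ <-]]; last exact: wG.
  apply: (grad_dot_ge xeps fx) => y Dy yx; apply: wG.
  by exists y.
have gsq : enorm g ^+ 2 <= rho ^+ 2 + q ^+ 2.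
  by apply: le_trans (sqle _ _ ga) _; rewrite sqrrD; lra.
(* Both squared norms are at most [rho ^+ 2 + q ^+ 2] while the inner product is at least
   [rho ^+ 2 - q ^+ 2]. *)
have gw : enorm (g - w) <= 2 * q.
  rewrite -(@ler_pXn2r _ 2%N) ?nnegrE ?enorm_ge0 ?mulr_ge0 ?(ltW q0) //.
  rewrite sqr_enormD dotNr enormN dotC; move: wsq; rewrite exprMn; lra.
have gG v : G v -> k <= dot g v.
  move=> Gv; have -> : g = w + (g - w) by rewrite addrC subrK.
  rewrite dotDl; have := wG v Gv.
  have : - (2 * q * L) <= dot (g - w) v.
    have := cauchy_schwarz_abs (g - w) v; rewrite ler_norml => /andP[hcs _].
    apply: le_trans hcs; rewrite lerN2; apply: ler_pM => //; try exact: enorm_ge0.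
    exact: GL.
  by rewrite /k; lra.
have kb : beta * enorm g ^+ 2 < k.
  apply: (@le_lt_trans _ _ (beta * (rho ^+ 2 + q ^+ 2))); first by rewrite ler_wpM2l // ltW.
  have : beta * q ^+ 2 <= q ^+ 2 by rewrite ler_piMl ?ltW.
  have : 0 < q * L by rewrite mulr_gt0.
  by rewrite /k; move: q2; rewrite mulrDr mulr1 mulrBl; lra.
move=> h /andP[h0 hc].
have hg4 : h * enorm g <= eps / 4.
  apply: (@le_trans _ _ (eps / (4 * (rho + 2)) * (rho + 2))).
    apply: ler_pM => //; [exact: ltW|exact: enorm_ge0|lra].
  by rewrite le_eqVlt; apply/orP; left; apply/eqP; field; rewrite gt_eqF // addr_gt0.
have ineq : f (x + - (h *: g)) - f x <= - (h * k).
  apply: (increment_le_of_grad_le rU uU fL oD nD fC.1 (z := xb) (r := eps)) => //.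
    rewrite addrAC; apply: le_lt_trans (ler_enormD _ _) _.
    by rewrite enormN enormZ gtr0_norm //; lra.
  move=> y Dy yz; rewrite dotNr dotZr dotC lerN2 ler_pM2l //; apply: gG.
  by exists y.
have : h * (beta * enorm g ^+ 2) < h * k by rewrite ltr_pM2l.
lra.
Qed.

End LocalDescent.

(** * A Borel-Cantelli lemma *)

Section BorelCantelli.
Variables (R : realType) (d : measure_display) (T : measurableType d)
  (P : probability T R) (E : nat -> set T) (p : R).
Hypotheses (mE : forall k, measurable (E k)) (p0 : 0 < p) (pE : forall k, p <= prob P (E k)).

Definition all_occur (S : seq nat) : set T := [set w | forall j, j \in S -> E j w].
Definition none_occurs (S : seq nat) : set T := [set w | forall j, j \in S -> ~ E j w].

Hypothesis indepE : forall k S, (forall j, j \in S -> (j < k)%N) ->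
  prob P (all_occur S `&` E k) = prob P (all_occur S) * prob P (E k).

Lemma probD (A B : set T) : measurable A -> measurable B ->
  prob P (A `\` B) = prob P A - prob P (A `&` B).
Proof.
move=> mA mB; rewrite /prob measureD //; last first.
  by apply: le_lt_trans (probability_le1 P mA) _; rewrite ltry.
by rewrite fineB // fin_num_measure //; exact: measurableI.
Qed.

Lemma prob_ge0 (A : set T) : 0 <= prob P A.
Proof. by rewrite fine_ge0. Qed.

Lemma none_occurs_cons j S : none_occurs (j :: S) = none_occurs S `\` E j.
Proof.
apply/seteqP; split => w /= h.
  by split => [i iS|]; apply: h; rewrite inE ?iS ?orbT ?eqxx.
by move=> i; rewrite inE => /orP[/eqP ->|]; [exact: h.2|exact: h.1].
Qed.

Lemma all_occur_cons j S : all_occur (j :: S) = all_occur S `&` E j.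
Proof.
apply/seteqP; split => w /= h.
  by split => [i iS|]; apply: h; rewrite inE ?iS ?orbT ?eqxx.
by move=> i; rewrite inE => /orP[/eqP ->|]; [exact: h.2|exact: h.1].
Qed.

Lemma measurable_all_occur S : measurable (all_occur S).
Proof.
elim: S => [|j S IH]; last by rewrite all_occur_cons; exact: measurableI.
by rewrite (_ : all_occur [::] = setT) //; apply/seteqP; split.
Qed.

Lemma measurable_none_occurs S : measurable (none_occurs S).
Proof.
elim: S => [|j S IH]; last by rewrite none_occurs_cons; exact: measurableD.
by rewrite (_ : none_occurs [::] = setT) //; apply/seteqP; split.
Qed.

(** The hypothesis [indepE] concerns intersections of earlier events. Complements follow by
    induction: subtracting the part where [E j] occurs moves [j] from [S1] to [S2]. *)
Lemma none_occurs_indep k S1 S2 :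
  (forall j, j \in S1 -> (j < k)%N) -> (forall j, j \in S2 -> (j < k)%N) ->
  prob P (none_occurs S1 `&` all_occur S2 `&` E k) =
  prob P (none_occurs S1 `&` all_occur S2) * prob P (E k).
Proof.
elim: S1 S2 => [|j S1 IH] S2 h1 h2.
  have -> : none_occurs [::] = setT by apply/seteqP; split.
  by rewrite setTI indepE.
have h1' i : i \in S1 -> (i < k)%N by move=> iS; apply: h1; rewrite inE iS orbT.
have h2' i : i \in j :: S2 -> (i < k)%N.
  by rewrite inE => /orP[/eqP ->|]; [apply: h1; rewrite inE eqxx|exact: h2].
have split_ (B : set T) : measurable B ->
    prob P (none_occurs (j :: S1) `&` all_occur S2 `&` B) =
    prob P (none_occurs S1 `&` all_occur S2 `&` B) -
    prob P (none_occurs S1 `&` all_occur (j :: S2) `&` B).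
  move=> mB; rewrite none_occurs_cons all_occur_cons.
  rewrite (_ : _ `&` B = (none_occurs S1 `&` all_occur S2 `&` B) `\` E j); last first.
    by apply/seteqP; split => w /=; tauto.
  rewrite probD //; last first.
    apply: measurableI => //; apply: measurableI; first exact: measurable_none_occurs.
    exact: measurable_all_occur.
  by congr (_ - prob P _); apply/seteqP; split => w /=; tauto.
have := split_ setT measurableT; rewrite !setIT => ->.
by rewrite split_ // !IH // mulrBl.
Qed.

Lemma prob_none_occurs_iota N l : prob P (none_occurs (iota N l)) <= (1 - p) ^+ l.
Proof.
have p1 : 0 <= 1 - p.
  rewrite subr_ge0; apply: le_trans (pE 0%N) _.
  by rewrite -lee_fin -probE // probability_le1.
elim: l => [|l IH].
  by rewrite expr0 -lee_fin -probE ?probability_le1 //; exact: measurable_none_occurs.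
have -> : none_occurs (iota N l.+1) = none_occurs (iota N l) `\` E (N + l)%N.
  rewrite -none_occurs_cons -addn1 iotaD /=; apply/seteqP.
  by split => w h j jS; apply: h; move: jS; rewrite mem_cat !inE orbC.
rewrite probD //; last exact: measurable_none_occurs.
have := @none_occurs_indep (N + l)%N (iota N l) [::].
have -> : all_occur [::] = setT by apply/seteqP; split.
rewrite setIT => -> //; last by move=> j; rewrite mem_iota => /andP[].
rewrite -[X in X - _]mulr1 -mulrBr exprSr; apply: ler_pM => //.
- exact: prob_ge0.
- by rewrite subr_ge0 -lee_fin -probE // probability_le1.
- by rewrite lerD2l lerN2.
Qed.

Lemma infinitely_often : {ae P, forall w, forall N, exists k, (N <= k)%N /\ E k w}.
Proof.
apply: ae_foralln => N; exists (\bigcap_l none_occurs (iota N l)).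
have mG : measurable (\bigcap_l none_occurs (iota N l)).
  by apply: bigcapT_measurable => l; exact: measurable_none_occurs.
split => //; last first.
  move=> w /= /forallNP h l _ j; rewrite mem_iota => /andP[Nj _] Ej.
  by apply: (h j).
have p1 : p <= 1.
  by apply: le_trans (pE 0%N) _; rewrite -lee_fin -probE // probability_le1.
have le l : prob P (\bigcap_l none_occurs (iota N l)) <= (1 - p) ^+ l.
  apply: le_trans (prob_none_occurs_iota N l).
  have mN := measurable_none_occurs (iota N l).
  rewrite -lee_fin -(probE P mG) -(probE P mN).
  by apply: le_measure; [exact: mem_set|exact: mem_set|exact: bigcap_inf].
have : (1 - p) ^+ l @[l --> \oo] --> 0.
  by apply: cvg_expr; rewrite ger0_norm ?subr_ge0 // ltrBlDr ltrDl.
move=> h; apply/eqP; rewrite eq_le measure_ge0 andbT [leLHS](probE P mG) lee_fin.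
rewrite -(cvg_lim (@Rhausdorff R) h); apply: limr_ge.
  by apply/cvg_ex; exists 0.
by near=> l; exact: le.
Unshelve. all: by end_near. Qed.

End BorelCantelli.

(** * Almost sure differentiability at the samples *)

Section RandomPoints.
Variables (R : realType) (n : nat) (d : measure_display) (T : measurableType d)
  (P : probability T R).
Local Notation V := 'rV[R]_n.
Local Notation B1 := (eball (0 : V) 1).

(** An enumeration of the rational points, with value 0 at integers that encode none. *)
Definition rat_point (j : nat) : V :=
  if @unpickle 'rV[rat]_n j is Some c then map_mx ratr c else 0.

Lemma rat_point_dense (y : V) (e : R) : 0 < e -> exists j, enorm (y - rat_point j) < e.
Proof.
move=> e0; pose e' := e / (n.+1%:R).
have e'0 : 0 < e' by rewrite divr_gt0.
have hc i : exists q : rat, `|y ord0 i - ratr q| < e'.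
  have [|q] := @rat_in_itvoo R (y ord0 i - e') (y ord0 i + e'); first by lra.
  by rewrite in_itv /= => /andP[h1 h2]; exists q; rewrite ltr_norml; lra.
have [c hc'] := choice hc.
exists (pickle (\row_i c i)); rewrite /rat_point pickleK.
apply: le_lt_trans (enorm_le_norm _) _; rewrite mulrC -ltr_pdivlMr //.
rewrite /Num.norm /= mx_normrE; apply/bigmax_ltP; split => // -[i j] _ /=.
by rewrite (ord1 i) !mxE.
Qed.

Lemma measurable_borelV (A : set V) :
  borelV A = measurable (A : set (g_sigma_algebraType [set U : set V | open U])).
Proof. by []. Qed.

Lemma borelV_seqDU (B : nat -> set V) : (forall j, open (B j)) -> forall j, borelV (seqDU B j).
Proof.
move=> oB j; rewrite measurable_borelV; apply: measurableD.
  exact: borelV_open.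
by apply: bigsetU_measurable => i _; exact: borelV_open.
Qed.

Variables (X U : T -> V) (D : set V).
Hypotheses (rX : random_vector X) (rU : random_vector U) (uU : uniform_unit_ball P U)
  (indepXU : forall A B, borelV A -> borelV B ->
     prob P (U @^-1` A `&` X @^-1` B) = prob P (U @^-1` A) * prob P (X @^-1` B))
  (oD : open D) (nD : lebesgue_null (~` D)).

(* [X] is localized in countably many small cells; on the cell around [q] the event is
   contained in [q + eps U] being close to the complement of [D], which the uniform law
   on one large ball controls independently of [q]. *)
Lemma conull_shift (eps : R) : 0 < eps -> {ae P, forall w, D (X w + eps *: U w)}.
Proof.
move=> eps0.
suff bounded M : P.-negligible [set w | enorm (X w) < M%:R /\ ~ D (X w + eps *: U w)].
  apply: negligibleS (negligible_bigcup bounded) => w /= nDw.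
  exists (Num.bound (enorm (X w))) => //=; split => //.
  exact/archi_boundP/enorm_ge0.
(* Open neighbourhoods of the complement of [D]; as [D] is open, they shrink to that complement. *)
pose N k := \bigcup_(v in ~` D) [set y : V | enorm (y - v) < k.+1%:R^-1].
have oN k : open (N k) by apply: bigcup_open => v _; exact: open_eball.
have k0 k : 0 < k.+1%:R^-1 :> R by rewrite invr_gt0.
have N_dec k l : (k <= l)%N -> N l `<=` N k.
  move=> kl y [v Dv /= yv]; exists v => //=; apply: lt_le_trans yv _.
  by rewrite lef_pV2 ?posrE // ler_nat.
(* A nonempty cell has its centre within [M + 1] of the origin, so this ball contains the [eps]-ball
   around that centre. *)
pose r : R := M%:R + 1 + eps.
have M1 : 0 < M%:R + 1 :> R by rewrite ltr_wpDl.
have r0 : 0 < r by rewrite addr_gt0.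
pose Q := (r / eps) ^+ n.
have Q0 : 0 < Q by rewrite exprn_gt0 // divr_gt0.
have approx e : 0 < e -> exists G, [/\ measurable G, (P G <= e%:E)%E &
    [set w | enorm (X w) < M%:R /\ ~ D (X w + eps *: U w)] `<=` G].
  move=> e0; have eQ : 0 < e / Q by rewrite divr_gt0.
  have [|k Pk] := @uniform_shrinking R n d T P U rU uU D 0 r N (e / Q) r0 oD nD eQ oN N_dec.
    move=> y _ yN Dy; have [a a0 ha] := (open_enormP D).1 oD _ Dy.
    have [v nDv /= yv] := yN (Num.bound a^-1).
    apply: nDv; apply: ha; rewrite enormBC; apply: lt_trans yv _.
    rewrite invf_plt ?posrE //; apply: lt_trans (archi_boundP _) _; first by rewrite invr_ge0 ltW.
    by rewrite ltr_nat.
  pose B j := [set y : V | enorm (y - rat_point j) < k.+1%:R^-1] `&` [set y : V | enorm (y - 0) < M%:R].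
  have oB j : open (B j) by apply: openI; exact: open_eball.
  pose A j := [set u : V | N k (rat_point j + eps *: u)].
  have bA j : borelV (A j) by apply: borelV_open; exact: open_affine.
  pose C j := U @^-1` A j `&` X @^-1` seqDU B j.
  have bC j := borelV_seqDU oB j.
  have mC j : measurable (C j) by apply: measurableI; [exact: rU|exact: rX].
  have CE j : (P (C j) <= e%:E * P (X @^-1` seqDU B j))%E.
    rewrite (probE P (mC j)) indepXU // EFinM -!probE; [|exact: rX|exact: rU].
    have [[y Qy]|/set0P/negP/negPn/eqP ->] := pselect (seqDU B j !=set0); last first.
      by rewrite preimage_set0 measure0 !mule0.
    rewrite lee_wpmul2r //.
    have [y1 y2] : B j y by case: Qy.
    rewrite /= in y1 y2.
    have sub : eball (rat_point j) eps `<=` eball 0 r.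
      move=> z; rewrite /eball /= => zz.
      have := ler_enormB_trans (rat_point j) z 0; have := ler_enormB_trans y (rat_point j) 0.
      rewrite (enormBC (rat_point j) y) /r.
      have : k.+1%:R^-1 <= 1 :> R by rewrite invf_le1 // ler1n.
      move: zz y1 y2; move: (k.+1%:R^-1 : R) (M%:R : R) => a b; lra.
    apply: le_trans (uniform_law_dominated rU uU eps0 r0 sub (oN k)) _.
    apply: (@le_trans _ _ (Q%:E * (e / Q)%:E)%E).
      by rewrite lee_pmul2l ?lte_fin // ltW.
    by rewrite -EFinM mulrCA divff ?mulr1 // gt_eqF.
  (* The cells were made disjoint so that their probabilities sum to at most 1, which leaves the
     total bound [e]. *)
  have trivX : trivIset setT (fun j => X @^-1` seqDU B j).
    by move=> i j _ _ [w [/= wi wj]]; apply: (trivIset_seqDU B) => //; exists (X w).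
  exists (\bigcup_j C j); split; first exact: bigcup_measurable.
  - apply: le_trans (measure_sigma_subadditive P mC (bigcup_measurable (fun j _ => mC j)) (@subset_refl _ _)) _.
    apply: (@le_trans _ _ (\sum_(0 <= j <oo) e%:E * P (X @^-1` seqDU B j))%E).
      by apply: lee_nneseries => // j _; exact: CE.
    rewrite nneseriesZl // -[leRHS]mule1; apply: lee_wpmul2l; first by rewrite lee_fin ltW.
    have mX : measurable (\bigcup_j X @^-1` seqDU B j).
      by apply: bigcup_measurable => j _; exact: rX.
    have h := @measure_semi_sigma_additive _ _ _ P _ (fun j => rX (bC j)) trivX mX.
    by rewrite (cvg_lim _ h) //; exact: probability_le1.
  - move=> w [XM nDw].
    have [j _ Bj] : (\bigcup_j seqDU B j) (X w).
      rewrite -seqDU_bigcup_eq; have [j hj] := rat_point_dense (X w) (k0 k).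
      by exists j => //; split => //=; rewrite subr0.
    exists j => //; split => //=; exists (X w + eps *: U w) => //=.
    rewrite opprD addrACA subrr addr0 enormBC.
    by case: Bj => -[].
pose G := fun l => sval (cid (approx _ (k0 l))).
have GP l : [/\ measurable (G l), (P (G l) <= (l.+1%:R^-1)%:E)%E &
    [set w | enorm (X w) < M%:R /\ ~ D (X w + eps *: U w)] `<=` G l].
  by rewrite /G; case: cid.
exists (\bigcap_l G l).
have mG : measurable (\bigcap_l G l) by apply: bigcapT_measurable => l; have [] := GP l.
split => //; last by move=> w hw l _; have [_ _] := GP l; apply.
apply/eqP; rewrite eq_le measure_ge0 andbT; apply/lee_addgt0Pr => e e0.
rewrite add0e; pose l := Num.bound e^-1.
have [mGl Gl _] := GP l.
apply: (@le_trans _ _ (P (G l))).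
  by apply: le_measure; [exact: mem_set|exact: mem_set|exact: bigcap_inf].
apply: le_trans Gl _; rewrite lee_fin ltW // invf_plt ?posrE //.
apply: lt_trans (archi_boundP _) _; first by rewrite invr_ge0 ltW.
by rewrite ltr_nat.
Qed.

End RandomPoints.

(** * Almost sure recurrence of the samples *)

Section SamplesHitBalls.
Variables (R : realType) (n m : nat) (d : measure_display) (T : measurableType d)
  (P : probability T R).
Local Notation V := 'rV[R]_n.
Local Notation B1 := (eball (0 : V) 1).
Variables (u : nat -> 'I_m -> T -> V) (x : nat -> T -> V).
Hypotheses (ru : forall k i, random_vector (u k i))
  (uu : forall k i, uniform_unit_ball P (u k i))
  (iu : forall k, mutually_indep P (u k))
  (ih : forall k, indep_families P (u k) (history x u k)).

Lemma measurable_cyl (I : eqType) (Y : I -> T -> V) (s : seq I) (A : I -> set V) :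
  (forall i, random_vector (Y i)) -> (forall i, borelV (A i)) -> measurable (cyl Y s A).
Proof.
move=> rY bA; elim: s => [|i s IH].
  by rewrite (_ : cyl _ _ _ = setT) //; apply/seteqP; split.
rewrite (_ : cyl _ _ _ = Y i @^-1` A i `&` cyl Y s A).
  by apply: measurableI => //; exact: rY.
apply/seteqP; split => w /= h.
  by split=> [|j js]; apply: h; rewrite inE ?js ?orbT ?eqxx.
by move=> j; rewrite inE => /orP[/eqP ->|]; [exact: h.1|exact: h.2].
Qed.

Lemma samples_hit_fixed_balls (c : 'I_m -> V) (r : R) :
  0 < r -> (forall i, eball (c i) r `<=` B1) ->
  {ae P, forall w, forall N, exists k, (N <= k)%N /\ forall i, enorm (u k i w - c i) < r}.
Proof.
move=> r0 sub.
pose A i := [set y : V | enorm (y - c i) < r].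
have bA i : borelV (A i) by apply: borelV_open; exact: open_eball.
pose E k := cyl (u k) (enum 'I_m) A.
have EP k w : E k w <-> forall i, enorm (u k i w - c i) < r.
  by split => [h i|h i _]; [apply: h; rewrite mem_enum|exact: h].
have mE k : measurable (E k) by exact: measurable_cyl.
pose p := \prod_(i <- enum 'I_m)
  (fine (leb_outer (A i `&` B1)) / fine (leb_outer (B1 : set V))).
have pE k : prob P (E k) = p.
  by rewrite iu ?enum_uniq //; apply: eq_bigr => i _; rewrite uu.
have p0 : 0 < p.
  apply: prodr_gt0 => i _; rewrite -(uu 0%N i (bA i)) -lte_fin.
  rewrite -probE; last exact: ru.
  exact: uniform_small_ball_gt0.
have indepE k S : (forall j, j \in S -> (j < k)%N) ->
    prob P (all_occur E S `&` E k) = prob P (all_occur E S) * prob P (E k).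
  move=> Sk.
  (* With no constraint at iterations outside [S], joint occurrence of earlier events becomes a
     cylinder over the history, to which [ih] applies. *)
  pose t : seq (hist_idx k m) := [seq inr (j, i) | j <- enum 'I_k, i <- enum 'I_m].
  pose B (h : hist_idx k m) : set V :=
    match h with inl _ => setT | inr (j, i) => if (j : nat) \in S then A i else setT end.
  have bB h : borelV (B h).
    case: h => [j|[j i]] /=; first by apply: borelV_open; exact: openT.
    by case: ifP => // _; apply: borelV_open; exact: openT.
  have -> : all_occur E S = cyl (history x u k) t B.
    apply/seteqP; split => w h.
      move=> q /allpairsP[[j i] [_ _ ->]] /=; case: ifP => // jS.
      by apply: (h j jS); rewrite mem_enum.
    move=> j jS i _; have jk := Sk j jS.
    have := h (inr (Ordinal jk, i)); rewrite /B /= jS; apply.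
    by apply/allpairsP; exists (Ordinal jk, i); rewrite !mem_enum.
  by rewrite setIC ih // mulrC.
apply: filterS (infinitely_often mE p0 _ indepE).
  by move=> w h N; have [k [Nk /EP]] := h N; exists k.
by move=> k; rewrite pE.
Qed.

(** The targets will depend on the limit of the realisation, so one null set must serve all of them.
    Rational centres and radii [1 / (l + 1)] leave countably many conditions. *)
Lemma samples_hit_balls :
  {ae P, forall w, forall (c : 'I_m -> V) (r : R), 0 < r -> (forall i, eball (c i) r `<=` B1) ->
    forall N, exists k, (N <= k)%N /\ forall i, enorm (u k i w - c i) < r}.
Proof.
pose good (q : {ffun 'I_m -> nat} * nat) w :=
  (forall i, eball (rat_point R n (q.1 i)) q.2.+1%:R^-1 `<=` B1) ->
  forall N, exists k, (N <= k)%N /\ forall i, enorm (u k i w - rat_point R n (q.1 i)) < q.2.+1%:R^-1.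
have ae_good q : {ae P, forall w, good q w}.
  have [sub|nsub] := pselect (forall i, eball (rat_point R n (q.1 i)) q.2.+1%:R^-1 `<=` B1).
    by apply: filterS (samples_hit_fixed_balls _ sub) => [w h _|]; last rewrite invr_gt0.
  by apply: nearW => w /nsub.
have : {ae P, forall w, forall j, if unpickle j is Some q then good q w else True}.
  by apply: ae_foralln => j; case: (unpickle j) => [q|]; [exact: ae_good|exact: nearW].
apply: filterS => w hw c r r0 sub N.
(* Since [2 / (l + 1) < r], a rational ball whose centre is within [1 / (l + 1)] of [c i] lies in
   the [r]-ball around [c i]. *)
pose l := Num.bound (2 / r).
have l0 : 0 < l.+1%:R^-1 :> R by rewrite invr_gt0.
have l2 : 2 * l.+1%:R^-1 < r.
  rewrite ltr_pdivrMr // mulrC -ltr_pdivrMr //; apply: lt_trans (archi_boundP _) _.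
    by rewrite divr_ge0 // ltW.
  by rewrite ltr_nat.
have [q hq] := choice (fun i => rat_point_dense (c i) l0).
have := hw (pickle ([ffun i => q i], l)); rewrite pickleK => /(_ _ N) [i y /=|k [Nk hk]].
  rewrite ffunE /eball /= => yq; apply: (sub i); rewrite /eball /=.
  have := ler_enormB_trans (rat_point R n (q i)) y (c i); have := hq i.
  rewrite (enormBC (rat_point R n (q i))); move: yq l2; move: (l.+1%:R^-1 : R) => a; lra.
exists k; split => // i.
have := hk i; rewrite /= ffunE => yq.
have := ler_enormB_trans (rat_point R n (q i)) (u k i w) (c i); have := hq i.
rewrite (enormBC (rat_point R n (q i))); move: yq l2; move: (l.+1%:R^-1 : R) => a; lra.
Qed.

End SamplesHitBalls.

(** * Limits of Clarke eps-subgradients *)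

Section ClarkeLimit.
Variables (R : realType) (n : nat).
Local Notation V := 'rV[R]_n.

Lemma ultra_fmap (T1 T2 : Type) (h : T1 -> T2) (F : set_system T1) :
  UltraFilter F -> UltraFilter (h @ F).
Proof.
move=> FU; apply: Build_UltraFilter => G GF sub.
apply/seteqP; split => // A GA.
have [//|FnA] := in_ultra_setVsetC (h @^-1` A) FU.
have : G (A `&` ~` A) by apply: filterI => //; exact: sub.
by rewrite setICr => /filter_not_empty.
Qed.

(** Limits along one ultrafilter replace successive extractions of subsequences. *)
Lemma compact_ultra_limit (W : topologicalType) (F : set_system nat) (K : set W) (h : nat -> W) :
  UltraFilter F -> compact K -> (\forall j \near F, K (h j)) ->
  exists p : W, h @ F --> p.
Proof.
move=> FU cK hK; have := ultra_fmap h FU => hU.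
by move: cK; rewrite compact_ultra => /(_ _ hU hK)[p [_ hp]]; exists p.
Qed.

Lemma cvg_sumr (T : Type) (F : set_system T) (FF : Filter F) (I : Type) (s : seq I)
    (h : I -> T -> R) (l : I -> R) :
  (forall i, h i @ F --> l i) -> (fun t => \sum_(i <- s) h i t) @ F --> \sum_(i <- s) l i.
Proof.
move=> hl; elim: s => [|i s IH].
  by rewrite big_nil (_ : (fun t => _) = fun=> 0);
    [exact: cvg_cst|apply/funext => t; rewrite big_nil].
rewrite big_cons (_ : (fun t => _) = (fun t => h i t + \sum_(i <- s) h i t)).
  by apply: cvgD.
by apply/funext => t; rewrite big_cons.
Qed.

Lemma clarke_subdiff_near (f : V -> R) (y v : V) :
  (forall e, 0 < e -> exists z,
     [/\ differentiable f z, enorm (z - y) < e & enorm (grad f z - v) < e]) ->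
  clarke_subdiff f y v.
Proof.
move=> h; apply: conv_sub.
have k0 k : 0 < k.+1%:R^-1 :> R by rewrite invr_gt0.
have [z hz] := choice (fun k => h _ (k0 k)).
have small (e : R) : 0 < e -> \forall k \near \oo, k.+1%:R^-1 < e :> R.
  by move=> e0; exact: near_infty_natSinv_lt (PosNum e0).
exists z; split; last split.
- apply/cvg_enormP => e /small; apply: filterS => k; apply: lt_trans.
  by have [] := hz k.
- by move=> k; have [] := hz k.
- apply/cvg_enormP => e /small; apply: filterS => k; apply: lt_trans.
  by have [] := hz k.
Qed.

(* By Caratheodory every [g k] is a combination of a fixed number of gradients, so
   the weights, the points and the gradients all converge along one ultrafilter. *)
Lemma clarke_eps_stationary_cluster (f : V -> R) (eps : R) (A : nat -> set V)
    (x g : nat -> V) (K : set nat) (xbar : V) :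
  locally_lipschitz f -> 0 < eps ->
  (forall k a, A k a -> exists y, [/\ differentiable f y, enorm (y - x k) <= eps & a = grad f y]) ->
  (forall k, conv (A k) (g k)) ->
  (forall delta, 0 < delta -> exists N, forall k, K k -> (N <= k)%N -> enorm (g k) < delta) ->
  (forall delta, 0 < delta -> forall N, exists k, K k /\ (N <= k)%N /\ enorm (x k - xbar) < delta) ->
  clarke_eps_stationary f eps xbar.
Proof.
move=> fL eps0 hA gA g0 xK.
have k0 j : 0 < j.+1%:R^-1 :> R by rewrite invr_gt0.
have sel j : exists k, [/\ enorm (x k - xbar) < j.+1%:R^-1 & enorm (g k) < j.+1%:R^-1].
  have [N hN] := g0 _ (k0 j); have [k [Kk [Nk xk]]] := xK _ (k0 j) N.
  by exists k; split => //; exact: hN.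
have [ks hks] := choice sel.
have rep j : exists ly : ('I_n.+1 -> R) * ('I_n.+1 -> V),
    [/\ forall i, 0 <= ly.1 i, \sum_i ly.1 i = 1,
      forall i, differentiable f (ly.2 i) /\ enorm (ly.2 i - x (ks j)) <= eps &
      g (ks j) = \sum_i ly.1 i *: grad f (ly.2 i)].
  have [l [a [l0 Aa l1 gE]]] := caratheodory (leqnn _) (gA (ks j)).
  have [y hy] := choice (fun i => hA _ _ (Aa i)).
  exists (l, y); split => //= [i|]; first by have [] := hy i.
  by rewrite gE; apply: eq_bigr => i _; have [_ _ ->] := hy i.
have [ly hly] := choice rep.
pose l j := (ly j).1; pose y j := (ly j).2.
have small (e : R) : 0 < e -> \forall j \near \oo, j.+1%:R^-1 < e :> R.
  by move=> e0; exact: near_infty_natSinv_lt (PosNum e0).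
have [F [FU sF]] := ultraFilterLemma (eventually_filter).
have FF : Filter F by exact: ultra_proper.
have smallF (e : R) (e0 : 0 < e) : F [set j : nat | j.+1%:R^-1 < e].
  exact (sF _ (small e e0)).
have yx j i : enorm (y j i - xbar) <= eps + j.+1%:R^-1.
  have [_ _ /(_ i)[_ yi] _] := hly j; have [xj _] := hks j.
  apply: le_trans (ler_enormB_trans (x (ks j)) _ _) _.
  by apply: lerD => //; exact: ltW.
have yball j i : eball xbar (eps + 1) (y j i).
  apply: le_trans (yx j i) _; rewrite lerD2l invf_le1 // ler1n //.
have [L L0 hL] := locally_lipschitz_uniform fL (@compact_eball R n xbar (eps + 1)).
have gradL j i : eball (0 : V) L (grad f (y j i)).
  rewrite /eball /= subr0; apply: norm_grad_le => //.
    by have [_ _ /(_ i)[]] := hly j.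
  by move=> z; apply: hL; exact: yball.
have /choice[yb hyb] i : exists p : V, (fun j => y j i) @ F --> p.
  by apply: (compact_ultra_limit FU (@compact_eball R n xbar (eps + 1))); apply: filterE => j.
have /choice[v hv] i : exists p : V, (fun j => grad f (y j i)) @ F --> p.
  by apply: (compact_ultra_limit FU (@compact_eball R n 0 L)); apply: filterE => j.
have l01 j i : 0 <= l j i <= 1.
  have [l0 l1 _ _] := hly j; rewrite l0 /= -l1 (bigD1 i) //= lerDl.
  by apply: sumr_ge0 => i' _; exact: l0.
have /choice[lam hlam] i : exists p : R, (fun j => l j i) @ F --> p.
  apply: (compact_ultra_limit FU (@segment_compact R 0 1)).
  by apply: filterE => j; rewrite /= in_itv /=; exact: l01.
have lam0 i : 0 <= lam i.
  rewrite -(cvg_lim (@Rhausdorff R) (hlam i)); apply: limr_ge; first by apply/cvg_ex; exists (lam i).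
  by apply: filterE => j; have /andP[] := l01 j i.
have lam1 : \sum_i lam i = 1.
  have h : (fun j => \sum_i l j i) @ F --> \sum_i lam i.
    exact: cvg_sumr.
  rewrite -(cvg_lim (@Rhausdorff R) h) (_ : (fun j => _) = fun=> 1); first exact: lim_cst.
  by apply/funext => j; have [] := hly j.
have lamv : \sum_i lam i *: v i = 0.
  apply/rowP => c; rewrite summxE mxE.
  have h : (fun j => g (ks j) ord0 c) @ F --> \sum_i (lam i *: v i) ord0 c.
    rewrite (_ : (fun j => _) = fun j => \sum_i l j i * grad f (y j i) ord0 c); last first.
      apply/funext => j; have [_ _ _ ->] := hly j; rewrite summxE.
      by apply: eq_bigr => i _; rewrite mxE.
    apply: cvg_sumr => i; rewrite mxE; apply: cvgM; first exact: hlam.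
    exact: (cvg_comp _ _ (hv i) (@coord_continuous R 1 n ord0 c (v i))).
  have h0 : (fun j => g (ks j) ord0 c) @ F --> (0 : R).
    apply/cvgrPdist_lt => e e0; apply: filterS (smallF e e0) => j /= je.
    rewrite sub0r normrN; apply: le_lt_trans (coord_le_enorm _ _) _.
    by apply: lt_trans je; have [] := hks j.
  by rewrite -(cvg_lim (@Rhausdorff R) h) (cvg_lim (@Rhausdorff R) h0).
rewrite /clarke_eps_stationary /clarke_eps_subdiff.
apply: (@convk_conv _ _ _ n.+1); exists lam, v; split => // i.
have near e : 0 < e -> exists j, [/\ enorm (y j i - yb i) < e, enorm (grad f (y j i) - v i) < e &
    j.+1%:R^-1 < e].
  move=> e0; have h1 := (cvg_enormP FF _ _).1 (hyb i) e e0.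
  have h2 := (cvg_enormP FF _ _).1 (hv i) e e0.
  have h3 := smallF e e0.
  have h4 : F ([set j | enorm (y j i - yb i) < e] `&` [set j | enorm (grad f (y j i) - v i) < e]
    `&` [set j : nat | j.+1%:R^-1 < e]) by apply: filterI => //; exact: filterI.
  by have [j [[? ?] ?]] := filter_ex h4; exists j.
(* In the limit the bound [eps + 1 / (j + 1)] on the distance to [xbar] becomes [eps]. *)
exists (yb i).
  apply/ler_addgt0Pr => e e0; have [j [h1 _ h3]] := near (e / 2) (divr_gt0 e0 (ltr0n R 2)).
  have := ler_enormB_trans (y j i) (yb i) xbar; rewrite (enormBC (yb i) (y j i)).
  by have := yx j i; move: h3; move: (j.+1%:R^-1 : R) => a; lra.
apply: clarke_subdiff_near => e e0; have [j [h1 h2 _]] := near e e0.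
by exists (y j i); split => //; have [_ _ /(_ i)[]] := hly j.
Qed.

End ClarkeLimit.

(** * Realisations of the algorithm *)

Section Run.
Variables (R : realType) (n m : nat) (d : measure_display) (T : measurableType d)
  (P : probability T R) (U : T -> 'rV[R]_n).
Hypotheses (rU : random_vector U) (uU : uniform_unit_ball P U).
Local Notation V := 'rV[R]_n.
Local Notation B1 := (eball (0 : V) 1).
Variables (f : V -> R) (D : set V) (x0 : V) (eps beta gamma theta_nu : R).
Hypotheses (fL : locally_lipschitz f) (oD : open D) (nD : lebesgue_null (~` D))
  (fC : C1_on f D) (fx0 : differentiable f x0) (eps0 : 0 < eps) (nm : (n.+1 <= m)%N)
  (beta01 : 0 < beta < 1) (gamma01 : 0 < gamma < 1).
Variables (x : nat -> V) (u : nat -> 'I_m -> V) (epsk nuk : nat -> R) (g : nat -> V)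
  (t : nat -> R).
(** From here on one outcome is fixed: [x] and [u] are sequences of values, and [uB], [uD] and [hit]
    are the almost sure properties. The random vector [U] is auxiliary and only supplies facts about
    [D]. *)
Let S k i := x k + epsk k *: u k i.
Let stop := GS_stop eps 0 epsk g.
Hypotheses
  (run : GS_run f x0 eps 0 beta gamma eps 0 1 theta_nu x S epsk nuk g t)
  (uB : forall k i, B1 (u k i)) (uD : forall k i, D (x k + eps *: u k i))
  (hit : forall (c : 'I_m -> V) r, 0 < r -> (forall i, eball (c i) r `<=` B1) ->
    forall N, exists k, (N <= k)%N /\ forall i, enorm (u k i - c i) < r).

Let gradients k := [set grad f (x k)] `|` [set grad f (S k i) | i in setT].

(** With both targets 0 and a constant radius, the reduction test coincides with the stopping test,
    so every iteration before termination takes the line search branch. *)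
Lemma run_invariant k : (forall j, (j < k)%N -> ~ stop j) ->
  [/\ epsk k = eps, nuk k = 0 & differentiable f (x k)].
Proof.
have [xE [eE [nE step]]] := run.
(* Strong induction, because [GS_run] describes a step only once all iterations up to it are known
   to be defined. *)
elim: k {-2}k (leqnn k) => [|K IH] k; first by rewrite leqn0 => /eqP -> _; rewrite xE.
case: k => [_ _|k kK ns]; first by rewrite xE.
have nsk j : (j < k)%N -> ~ stop j by move=> jk; apply: ns; rewrite ltnS ltnW.
have def j : (j <= k)%N -> GS_defined_at f x S j.
  move=> jk; have [|ej _ fj] := IH j (leq_trans jk kK).
    by move=> i ij; apply: nsk; exact: leq_trans jk.
  by split => // i; apply: fC.1; rewrite /S ej; exact: uD.
have [ek nk fk] := IH k kK nsk.
have [_ /(_ (ns k (ltnSn k)))[[_ h1] [h2 h3]]] := step k def nsk.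
have /h1 [nk1 [ek1 _]] : ~ enorm (g k) <= nuk k.
  by rewrite nk => gk; apply: (ns k (ltnSn k)); split; rewrite ?ek.
split; [by rewrite ek1|by rewrite nk1|].
have [h|h] := pselect (differentiable f (x k - t k *: g k)).
  by rewrite (h2 h).
by have [] := h3 h.
Qed.

Lemma run_defined k : (forall j, (j < k)%N -> ~ stop j) -> GS_defined_at f x S k.
Proof.
move=> ns; have [ek _ fk] := run_invariant ns.
by split => // i; apply: fC.1; rewrite /S ek; exact: uD.
Qed.

Section Forever.
Hypothesis never : forall k, ~ stop k.

Lemma run_eps k : epsk k = eps.
Proof. by have [] := @run_invariant k (fun j _ => @never j). Qed.

Lemma run_diff k : differentiable f (x k).
Proof. by have [] := @run_invariant k (fun j _ => @never j). Qed.

Lemma run_step k : min_norm_elt (gradients k) (g k) /\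
  [/\ 0 < enorm (g k), f (x k.+1) < f (x k) - beta * t k * enorm (g k) ^+ 2,
    enorm (x k.+1 - x k) <= 2 * t k * enorm (g k) &
    exists j, t k = gamma ^+ j /\ forall j', (j' < j)%N ->
      ~ (f (x k - gamma ^+ j' *: g k) < f (x k) - beta * gamma ^+ j' * enorm (g k) ^+ 2)].
Proof.
have [_ [_ [_ step]]] := run.
have [mn /(_ (@never k))[[_ h1] [h2 h3]]] :=
  step k (fun j _ => @run_defined j (fun i _ => @never i)) (fun j _ => @never j).
have [ek nk _] := @run_invariant k (fun j _ => @never j).
have gk : ~ enorm (g k) <= nuk k.
  by rewrite nk => gk; apply: (@never k); split; rewrite ?ek.
have [_ [_ [j [tj [dec first]]]]] := h1 gk.
have g_gt0 : 0 < enorm (g k) by rewrite ltNge -nk; exact/negP.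
have tp : 0 < t k by rewrite tj exprn_gt0 //; case/andP: gamma01.
split => //.
have [h|h] := pselect (differentiable f (x k - t k *: g k)).
  have tg : 0 < t k * enorm (g k) by rewrite mulr_gt0.
  split => //; [by rewrite (h2 h)| |by exists j].
  rewrite (h2 h) addrAC subrr add0r enormN enormZ gtr0_norm //; lra.
have [_ [hd hx]] := h3 h; split => //; last by exists j.
apply: le_trans (ler_enormB_trans (x k - t k *: g k) _ _) _.
rewrite (addrAC (x k)) subrr add0r enormN enormZ gtr0_norm // (enormBC (x k.+1)).
(* The random perturbation is no longer than the step itself, whence the factor 2. *)
have : Num.min (t k) (epsk k) * enorm (g k) <= t k * enorm (g k).
  by rewrite ler_wpM2r ?enorm_ge0 // ge_min lexx.
move: hx; lra.
Qed.

Lemma run_decr k : f (x k.+1) <= f (x k).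
Proof.
have [_ [gp hd _ [j [tj _]]]] := run_step k.
apply: ltW; apply: lt_trans hd _; rewrite ltrBlDr ltrDl.
have [/andP[b0 _] /andP[g0 _]] := (beta01, gamma01).
by rewrite !mulr_gt0 ?exprn_gt0 // tj exprn_gt0.
Qed.

Lemma run_decr_le k l : (k <= l)%N -> f (x l) <= f (x k).
Proof.
move=> /subnK <-; elim: (l - k)%N => // i IH.
by rewrite addSn; apply: le_trans (run_decr _) IH.
Qed.

(** A step has length at most [2 * t * enorm g] and lowers [f] by more than
    [beta * c * t * enorm g]; the quotient of the two telescopes. *)
Lemma run_path_length N c : 0 < c -> (forall k, (N <= k)%N -> c <= enorm (g k)) ->
  forall k l, (N <= k)%N -> (k <= l)%N ->
    enorm (x l - x k) <= 2 / (beta * c) * (f (x k) - f (x l)).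
Proof.
have [/andP[b0 _] /andP[g0 _]] := (beta01, gamma01).
move=> c0 hc k l Nk /subnK <-; elim: (l - k)%N => [|i IH].
  by rewrite !subrr enorm0 mulr0.
rewrite addSn; set p := (i + k)%N.
have [_ [gp hd hx [j [tj _]]]] := run_step p.
have tp : 0 < t p by rewrite tj exprn_gt0.
apply: le_trans (ler_enormB_trans (x p) _ _) _.
have : enorm (x p.+1 - x p) <= 2 / (beta * c) * (f (x p) - f (x p.+1)).
  apply: le_trans hx _; rewrite [leRHS]mulrAC ler_pdivlMr ?mulr_gt0 //.
  have gc := hc p (leq_trans Nk (leq_addl _ _)).
  have : beta * t p * enorm (g p) * c <= beta * t p * enorm (g p) * enorm (g p).
    by rewrite ler_pM2l // !mulr_gt0.
  lra.
move: IH; rewrite !mulrBr; lra.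
Qed.

(** Otherwise the finite path length makes [x] converge. Samples that suit [local_descent] at the
    limit recur arbitrarily late and force a decrease of [f] by a fixed amount, which the tail of a
    bounded decreasing sequence excludes. *)
Lemma run_small_gradients A : (forall k, A < f (x k)) ->
  forall c N, 0 < c -> exists k, (N <= k)%N /\ enorm (g k) < c.
Proof.
have [/andP[b0 b1] /andP[g0 g1]] := (beta01, gamma01).
move=> hA c N c0; apply: contrapT => /forallNP hN.
have {}hN k : (N <= k)%N -> c <= enorm (g k).
  by move=> Nk; rewrite leNgt; apply/negP => gk; apply: (hN k).
have path := run_path_length c0 hN.
pose C := 2 / (beta * c).
have C0 : 0 < C by rewrite divr_gt0 // mulr_gt0.
have tail e : 0 < e -> exists M, (N <= M)%N /\
    forall k l, (M <= k)%N -> (M <= l)%N -> f (x k) - f (x l) < e.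
  move=> e0; pose F := [set f (x k) | k in setT].
  have F0 : has_inf F.
    by split; [exists (f (x 0%N)); exists 0%N|exists A => _ [k _ <-]; exact: ltW].
  have [_ [M _ <-] hM] := inf_adherent e0 F0.
  exists (maxn M N); split=> [|k l]; first exact: leq_maxr.
  rewrite !geq_max => /andP[Mk _] _.
  have : inf F <= f (x l) by apply: ge_inf; [exact: F0.2|exists l].
  by have := run_decr_le Mk; lra.
have [xb hxb] : exists xb, cluster (x @ \oo) xb.
  have [M [NM hM]] := tail 1 ltr01.
  have xM : \forall k \near \oo, eball (x M) (C * 1) (x k).
    exists M => // k /= Mk; have := path M k NM Mk; move=> /le_trans; apply.
    by rewrite ler_pM2l // ltW // hM.
  have [xb [_ h]] := @compact_eball R n (x M) (C * 1) (x @ \oo) _ xM.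
  by exists xb.
have lim e : 0 < e -> exists M, forall k, (M <= k)%N -> enorm (x k - xb) < e.
  move=> e0; have e2 : 0 < e / 2 / C by apply: divr_gt0 => //; apply: divr_gt0.
  have [M [NM hM]] := tail _ e2.
  have tailM : (x @ \oo) [set y | exists2 k, (M <= k)%N & y = x k].
    by exists M => // k /= Mk; exists k.
  have near_xb : nbhs xb [set y | enorm (y - xb) < e / 2].
    by apply/near_enormP; exists (e / 2) => //; exact: divr_gt0.
  have [_ [[k Mk ->] /= xk]] := hxb _ _ tailM near_xb.
  exists k => l kl; apply: le_lt_trans (ler_enormB_trans (x k) _ _) _.
  have := path k l (leq_trans NM Mk) kl.
  have : C * (f (x k) - f (x l)) < e / 2.
    by rewrite mulrC -ltr_pdivlMr //; apply: hM => //; exact: leq_trans kl.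
  by rewrite -/C; lra.
have c2 : 0 < c / 2 by rewrite divr_gt0.
have [tau [c1 [eta [ys [tau0 c10 eta0 sub descent]]]]] :=
  local_descent rU uU fL oD nD fC xb eps0 c2 beta01 nm.
(* Either the line search accepts 1, or the last rejected trial exceeds [c1] and the accepted step
   is [gamma] times it. *)
pose t0 := Num.min 1 (gamma * c1).
have t00 : 0 < t0 by rewrite lt_min ltr01 mulr_gt0.
have [M1 hM1] := lim _ tau0.
have [M2 hM2] := lim (eta / 2) (divr_gt0 eta0 (ltr0n R 2)).
have e0 : 0 < beta * t0 * c ^+ 2 by rewrite !mulr_gt0 ?exprn_gt0.
have [M3 [NM3 hM3]] := tail _ e0.
have r0 : 0 < eta / 2 / eps by rewrite !divr_gt0.
have epsE (y : V) : xb + eps *: (eps^-1 *: (y - xb)) = y.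
  by rewrite scalerA divff ?gt_eqF // scale1r addrC subrK.
have epsB (v y : V) : enorm (xb + eps *: v - y) = eps * enorm (v - eps^-1 *: (y - xb)).
  rewrite -[X in X * _](gtr0_norm eps0) -enormZ; congr enorm.
  rewrite scalerBr scalerA divff ?gt_eqF // scale1r.
  by apply/rowP => i; rewrite !mxE; ring.
(* The targets [ys i] are expressed in coordinates of the [eps]-ball around [xb]. Half of [eta] is
   kept for the displacement from [xb] to [x k]. *)
have [|k [Mk uk]] := hit r0 (c := fun i => eps^-1 *: (ys i - xb)) _ (maxn (maxn M1 M2) M3).
  move=> i v; rewrite /eball /= ler_pdivlMr // mulrC -epsB => hv.
  have : eball xb eps (xb + eps *: v) by apply: (sub i); rewrite /eball /=; lra.
  by rewrite /eball /= addrC addKr enormZ gtr0_norm // subr0 -[X in _ <= X -> _]mulr1 ler_pM2l.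
move: Mk; rewrite !geq_max => /andP[/andP[Mk1 Mk2] Mk3].
have Sy i : enorm (S k i - ys i) < eta.
  have := uk i; rewrite ltr_pdivlMr // mulrC -epsB => h.
  have := hM2 k Mk2; have := ler_enormB_trans (xb + eps *: u k i) (S k i) (ys i).
  have -> : S k i - (xb + eps *: u k i) = x k - xb.
    by rewrite /S run_eps; apply/rowP => j; rewrite !mxE; ring.
  lra.
have [gmin [gp hd _ [j [tj first]]]] := run_step k.
have gc := hN k (leq_trans NM3 Mk3).
case: (descent _ _ _ (hM1 k Mk1) (run_diff k) Sy gmin) => [|hdesc]; first by lra.
have t0k : t0 <= t k.
  case: j tj first => [-> _|j tj first]; first by rewrite expr0 ge_min lexx.
  rewrite ge_min; apply/orP; right; rewrite tj exprS ler_pM2l //.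
  rewrite leNgt; apply/negP => gj; apply: (first j (ltnSn j)).
  by apply: hdesc; rewrite exprn_gt0 // ltW.
have := hM3 k k.+1 Mk3 (leqW Mk3).
have : beta * t0 * c ^+ 2 <= beta * t k * enorm (g k) ^+ 2.
  apply: ler_pM; rewrite ?sqr_ge0 ?mulr_ge0 ?(ltW t00) ?(ltW b0) //.
    by rewrite ler_pM2l.
  by rewrite ler_pXn2r ?nnegrE ?enorm_ge0 ?(ltW c0).
lra.
Qed.

Lemma run_stationary A : (forall k, A < f (x k)) ->
  exists K : set nat,
    (forall N, exists k, K k /\ (N <= k)%N) /\
    (forall delta, 0 < delta -> exists N, forall k, K k -> (N <= k)%N ->
       enorm (g k) < delta) /\
    (forall xbar : V,
       (forall delta, 0 < delta -> forall N, exists k,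
          K k /\ (N <= k)%N /\ enorm (x k - xbar) < delta) ->
       clarke_eps_stationary f eps xbar).
Proof.
move=> hA; have small := run_small_gradients hA.
have gp k : 0 < enorm (g k) by have [_ []] := run_step k.
pose K := [set k | forall j, (j < k)%N -> enorm (g k) < enorm (g j)].
have Ksmall delta : 0 < delta -> exists N, forall k, K k -> (N <= k)%N -> enorm (g k) < delta.
  move=> d0; have [N [_ gN]] := small delta 0%N d0.
  by exists N.+1 => k Kk Nk; apply: lt_trans gN; exact: Kk.
exists K; split; last split => //.
  (* The first index with norm below [a], a lower bound for the indices up to [N], is a record low
     beyond [N]. *)
  move=> N; have [a a0 ha] := finite_pos_lower_bound (fun i : 'I_N.+1 => gp i).
  have [k0 [_ gk0]] := small a 0%N a0.
  have [k gk kmin] := ex_minnP (ex_intro (fun k => enorm (g k) < a) k0 gk0).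
  have Nlt j : (j <= N)%N -> a <= enorm (g j).
    by move=> jN; exact: (ha (Ordinal (jN : (j < N.+1)%N))).
  exists k; split; last first.
    by rewrite leqNgt; apply/negP => kN; have := Nlt k (ltnW kN); rewrite leNgt gk.
  move=> j jk; apply: lt_le_trans gk _; rewrite leNgt; apply/negP => gj.
  by have := kmin j gj; rewrite leqNgt jk.
move=> xbar hx.
apply: (@clarke_eps_stationary_cluster R n f eps gradients x g K xbar) => //.
- move=> k _ [->|[i _ <-]].
    by exists (x k); rewrite subrr enorm0 (ltW eps0); split => //; exact: run_diff.
  exists (S k i); split => //.
    by apply: fC.1; rewrite /S run_eps; exact: uD.
  rewrite /S run_eps addrC addKr enormZ gtr0_norm //; apply: ler_piMr; first exact: ltW.
  by have := uB k i; rewrite /eball /= subr0.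
- by move=> k; have [[]] := run_step k.
Qed.

End Forever.

Lemma run_alternatives :
  (forall k, (forall j, (j < k)%N -> ~ stop j) -> GS_defined_at f x S k) /\
  ( ((forall k, ~ stop k) /\ (forall k, f (x k.+1) <= f (x k)) /\
      (fun k => f (x k)) @ \oo --> -oo)
    \/
    (exists k, (forall j, (j < k)%N -> ~ stop j) /\ stop k /\ g k = 0)
    \/
    ((forall k, ~ stop k) /\
     exists K : set nat,
       (forall N, exists k, K k /\ (N <= k)%N) /\
       (forall delta, 0 < delta -> exists N, forall k, K k -> (N <= k)%N ->
          enorm (g k) < delta) /\
       (forall xbar : V,
          (forall delta, 0 < delta -> forall N, exists k,
             K k /\ (N <= k)%N /\ enorm (x k - xbar) < delta) ->
          clarke_eps_stationary f eps xbar))).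
Proof.
split; first exact: run_defined.
have [[k0 sk0]|/forallNP never] := pselect (exists k, stop k).
  right; left.
  have [k /asboolP sk kmin] := ex_minnP (ex_intro (fun k => `[< stop k >]) k0 (asboolT sk0)).
  exists k; split.
    by move=> j jk sj; have := kmin j (asboolT sj); rewrite leqNgt jk.
  by split => //; apply: enorm_le0; case: sk.
(* Since the values decrease, the absence of a lower bound already gives divergence to [-oo]. *)
have [[A hA]|unbdd] := pselect (exists A, forall k, A < f (x k)).
  by right; right; split => //; exact: run_stationary hA.
left; split => //; split; first exact: run_decr.
apply/cvgrNyPle => A.
have [N hN] : exists N, f (x N) <= A.
  apply: contrapT => /forallNP h; apply: unbdd; exists A => k.
  by rewrite ltNge; exact/negP.
by exists N => // k /= Nk; apply: le_trans hN; exact: run_decr_le.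
Qed.

End Run.

Theorem theorem3p2 (R : realType) (n m : nat) (f : 'rV[R]_n -> R) (D : set 'rV[R]_n)
  (x0 : 'rV[R]_n) (eps beta gamma theta_nu : R)
  (d : measure_display) (T : measurableType d) (P : probability T R)
  (u : nat -> 'I_m -> T -> 'rV[R]_n)
  (x : nat -> T -> 'rV[R]_n) (epsk nuk : nat -> T -> R)
  (g : nat -> T -> 'rV[R]_n) (t : nat -> T -> R) :
                       
  locally_lipschitz f ->
  open D -> lebesgue_null (~` D) -> C1_on f D ->
                                                                                   
  differentiable f x0 ->
  0 < eps -> (n.+1 <= m)%N ->
  0 < beta < 1 -> 0 < gamma < 1 -> 0 < theta_nu <= 1 ->
                                                                                    
                                                                       
  (forall k i, random_vector (u k i)) ->
  (forall k, random_vector (x k)) ->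
  (forall k i, uniform_unit_ball P (u k i)) ->
  (forall k, mutually_indep P (u k)) ->
  (forall k, indep_families P (u k) (history x u k)) ->
                                              
  (forall w, GS_run f x0 eps 0 beta gamma eps 0 1 theta_nu
       (fun k => x k w) (fun k i => x k w + epsk k w *: u k i w)
       (fun k => epsk k w) (fun k => nuk k w) (fun k => g k w) (fun k => t k w)) ->
  {ae P, forall w,
    let S := fun k i => x k w + epsk k w *: u k i w in
    let stop := GS_stop eps 0 (fun k => epsk k w) (fun k => g k w) in
                                                                             
    (forall k, (forall j, (j < k)%N -> ~ stop j) ->
       GS_defined_at f (fun k => x k w) S k) /\
    (          
      ((forall k, ~ stop k) /\ (forall k, f (x k.+1 w) <= f (x k w)) /\
        (fun k => f (x k w)) @ \oo --> -oo)
      \/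
               
      (exists k, (forall j, (j < k)%N -> ~ stop j) /\ stop k /\ g k w = 0)
      \/
               
      ((forall k, ~ stop k) /\
       exists K : set nat,
         (forall N, exists k, K k /\ (N <= k)%N) /\
         (forall delta, 0 < delta -> exists N, forall k, K k -> (N <= k)%N ->
            enorm (g k w) < delta) /\
         (forall xbar : 'rV[R]_n,
            (forall delta, 0 < delta -> forall N, exists k,
               K k /\ (N <= k)%N /\ enorm (x k w - xbar) < delta) ->
            clarke_eps_stationary f eps xbar))) }.
Proof.
move=> fL oD nD fC fx0 eps0 nm beta01 gamma01 _ ru rx uu iu ih run.
(* There is thus a first sample, which serves as the auxiliary uniform vector. *)
have m0 : (0 < m)%N by apply: leq_trans nm.
have cyl1 (I : eqType) (Y : I -> T -> 'rV[R]_n) i (A : set 'rV[R]_n) :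
    cyl Y [:: i] (fun=> A) = Y i @^-1` A.
  apply/seteqP; split => w h /=; first by apply: (h i); rewrite inE.
  by move=> j; rewrite inE => /eqP ->.
have in_ball : {ae P, forall w, forall k i, eball (0 : 'rV[R]_n) 1 (u k i w)}.
  apply: ae_foralln => k; apply: filter_forall => i.
  exists [set w | ~ eball (0 : 'rV[R]_n) 1 (u k i w)]; split => //; last first.
    exact: uniform_in_unit_ball.
  apply: (ru k i (~` eball 0 1)); apply: borelV_setC; apply: borelV_closed.
  exact: closed_eball.
have in_D : {ae P, forall w, forall k i, D (x k w + eps *: u k i w)}.
  apply: ae_foralln => k; apply: filter_forall => i.
  apply: conull_shift => // A B bA bB.
  (* The index [inl ord_max] selects the current iterate [x k] in the history. *)
  have := ih k [:: i] [:: inl ord_max] (fun=> A) (fun=> B) (fun=> bA) (fun=> bB).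
  by rewrite !cyl1.
apply: filterS (filterI (filterI in_ball in_D) (samples_hit_balls ru uu iu ih)).
move=> w [[uB uD] hit].
exact: (run_alternatives (ru 0%N (Ordinal m0)) (uu 0%N (Ordinal m0)) fL oD nD fC fx0 eps0 nm
  beta01 gamma01 (run w) uB uD hit).
Qed.
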